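(* Let $H$ be a complex Hilbert space, and let $(a,j)$ be a quasi-sectorial form in $H$. For each $n\in\mathbb{N}$ let $a_n$ be a sesquilinear form whose domain $\operatorname{dom}(a_n)$ is a linear subspace of $\operatorname{dom}(a)$. Let $\theta\in[0,\frac{\pi}{2})$, and assume that $$a_n(u)-a(u)\in\overline{\Sigma_\theta}\qquad(u\in\operatorname{dom}(a_n),\ n\in\mathbb{N}).$$ Let $D$ be a core for $a$, and suppose that for all $u\in D$ there exists a sequence $(u_n)_{n\in\mathbb{N}}$ in $\operatorname{dom}(a)$ with $u_n\in\operatorname{dom}(a_n)$ for all $n\in\mathbb{N}$, such that $u_n\to u$ in $\operatorname{dom}(a)$ and $a_n(u_n)-a(u_n)\to0$ as $n\to\infty$. Let $A$ be the linear relation associated with $(a,j)$, and for $n\in\mathbb{N}$ let $A_n$ be the linear relation associated with $(a_n,j|_{\operatorname{dom}(a_n)})$. Then $(A_n)$ converges to $A$ in the strong resolvent sense, i.e., for every vertex $\gamma$ of $(a,j)$ and every real $\lambda>-\gamma$ one has $(\lambda+A_n)^{-1}x\to(\lambda+A)^{-1}x$ in $H$ as $n\to\infty$, for all $x\in H$.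
   Context: Sesquilinear forms are linear in the first and antilinear in the second argument, as is the scalar product $(\cdot\mid\cdot)_H$ of $H$. For a sesquilinear form $a$ on a complex vector space $\operatorname{dom}(a)$ write $a(u):=a(u,u)$ and $(\operatorname{Re}a)(x,y):=\frac12\bigl(a(x,y)+\overline{a(y,x)}\bigr)$. For $\theta\in[0,\pi/2)$ let $\Sigma_\theta:=\{re^{i\alpha};\ r>0,\ \alpha\in(-\theta,\theta)\cup\{0\}\}\subseteq\mathbb{C}$, with closure $\overline{\Sigma_\theta}$. **Forms in $H$.** A form in $H$ is a couple $(a,j)$, where $a$ is a sesquilinear form on a complex vector space $\operatorname{dom}(a)$ and $j\colon\operatorname{dom}(a)\to H$ is linear (no density of $\operatorname{ran}(j)$, no injectivity of $j$, and no closedness or closability is assumed). It is quasi-sectorial of angle $\theta\in[0,\pi/2)$ with vertex $\gamma\in\mathbb{R}$ if $a(u)-\gamma\|j(u)\|_H^2\in\overline{\Sigma_\theta}$ for all $u\in\operatorname{dom}(a)$. It is called quasi-sectorial if this holds for some angle in $[0,\pi/2)$ and some vertex $\gamma\in\mathbb{R}$. It is sectorial if $a(u)\in\overline{\Sigma_\theta}$ for all $u\in\operatorname{dom}(a)$, for some $\theta\in[0,\pi/2)$. **Topology of $\operatorname{dom}(a)$.** If $(a,j)$ is quasi-sectorial with vertex $\gamma$, then $\operatorname{dom}(a)$ is equipped with the semi-inner product $(x\mid y)_{a_{-\gamma},j}:=(\operatorname{Re}a)(x,y)+(1-\gamma)(j(x)\mid j(y))_H$ and the corresponding seminorm (different vertices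 give equivalent seminorms). Convergence $u_n\to u$ in $\operatorname{dom}(a)$ is with respect to this seminorm. A core for $a$ is a linear subspace of $\operatorname{dom}(a)$ that is dense with respect to this seminorm. **Associated linear relation.** A linear relation in $H$ is a linear subspace of $H\times H$. First let $(a,j)$ be sectorial. Let $(V,q)$ be the completion of $\operatorname{dom}(a)$ with respect to the semi-inner product $(x\mid y)_{a,j}:=(\operatorname{Re}a)(x,y)+(j(x)\mid j(y))_H$; that is, $V$ is a Hilbert space and $q\colon\operatorname{dom}(a)\to V$ is linear with dense range and $(x\mid y)_{a,j}=(q(x)\mid q(y))_V$. Let $\tilde\jmath\colon V\to H$ and $\tilde a\colon V\times V\to\mathbb{C}$ be the unique continuous linear operator and unique continuous sesquilinear form with $\tilde\jmath\circ q=j$ and $\tilde a(q(x),q(y))=a(x,y)$. The linear relation associated with $(a,j)$ is $$A:=\{(x,y)\in H\times H;\ \exists\,u\in V:\ \tilde\jmath(u)=x,\ \tilde a(u,v)=(y\mid\tilde\jmath(v))_H\ \text{for all } v\in V\}.$$ (It equals $A_1\oplus(\{0\}\times\operatorname{ran}(j)^\perp)$ with an m-sectorial operator $A_1$ in $\overline{\operatorname{ran}(j)}$.) If $(a,j)$ is quasi-sectorial with vertex $\gamma$, put $a_{-\gamma}(x,y):=a(x,y)-\gamma(j(x)\mid j(y))_H$, let $A_{-\gamma}$ be the linear relation associated with the sectorial form $(a_{-\gamma},j)$, and define the linear relation associated with $(a,j)$ by $A:=\{(x,y+\gamma x);\ (x,y)\in A_{-\gamma}\}$; this does not depend on the choice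 of the vertex $\gamma$. In the claim, the hypothesis on $a_n-a$ implies that each $(a_n,j|_{\operatorname{dom}(a_n)})$ is quasi-sectorial with the same vertex $\gamma$ as $(a,j)$, so $A_n$ is defined. **Resolvents.** For a linear relation $B$ and $\lambda\in\mathbb{R}$: $\lambda+B:=\{(x,y+\lambda x);\ (x,y)\in B\}$ and $B^{-1}:=\{(y,x);\ (x,y)\in B\}$. For $\lambda>-\gamma$ the relations $(\lambda+A)^{-1}$ and $(\lambda+A_n)^{-1}$ are (graphs of) bounded linear operators defined on all of $H$. *)

(* Defs.v *)
From HB Require Import structures.
From mathcomp Require Import all_boot all_order all_algebra.
From mathcomp Require Import complex.
From mathcomp Require Import all_classical all_reals all_analysis.

Set Implicit Arguments.
Unset Strict Implicit.
Unset Printing Implicit Defensive.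

Import Order.TTheory GRing.Theory Num.Theory.
Import numFieldNormedType.Exports.

Local Open Scope classical_set_scope.
Local Open Scope ring_scope.
Local Open Scope complex_scope.

(* Declared as a [numClosedFieldType] so that the topology of numeric fields
   applies; it is not inferred for the bare record type [R[i]]. *)
Definition Cx (R : realType) : numClosedFieldType := R[i].

Definition toC (R : realType) (x : R) : Cx R := x%:C.

Definition toRe (R : realType) (z : Cx R) : R := complex.Re z.

(* Linear in the first argument, antilinear in the second. *)
Notation sesquiform R E :=
  {bilinear E -> E -> Cx R | *%R & (@Num.conj (Cx R) \; *%R)}.

HB.mixin Record isHilbert (R : realType) H of CompleteNormedModule (Cx R) H := {
  inner : {dot H for @Num.conj (Cx R)};
  inner_norm : forall x : H, inner x x = `|x| ^+ 2
}.

#[short(type="hilbertType")]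
HB.structure Definition Hilbert (R : realType) :=
  {H of CompleteNormedModule (Cx R) H & isHilbert R H}.

Section Defs.
Variable R : realType.
Local Notation C := (Cx R).

Definition sector (theta : R) : set C :=
  [set z | exists r alpha : R,
     [/\ 0 < r, (- theta < alpha < theta) \/ alpha = 0
       & z = ((r * cos alpha) +i* (r * sin alpha) : C)]].

Section Forms.
Variables (H : hilbertType R) (E : lmodType C).
Implicit Types (a : E -> E -> C) (j : E -> H) (g : R).

Definition sectorial_angle theta a := forall u, closure (sector theta) (a u u).

Definition is_angle (theta : R) := 0 <= theta < pi / 2.

Definition quasi_sectorial_with theta g a j :=
  forall u, closure (sector theta) (a u u - toC g * `|j u| ^+ 2).

Definition is_vertex a j g :=
  exists2 theta, is_angle theta & quasi_sectorial_with theta g a j.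

Definition quasi_sectorial a j := exists g, is_vertex a j g.

Definition re_form a (x y : E) : C := 2^-1 * (a x y + (a y x)^*%R).

(* This is [form_sip] below for the form [shift_form a j g]. *)
Definition vertex_sip a j g (x y : E) : C :=
  re_form a x y + toC (1 - g) * inner (j x) (j y).

Definition vertex_seminorm a j g (x : E) : R :=
  Num.sqrt (toRe (vertex_sip a j g x x)).

(* Different vertices give equivalent seminorms, so it does not matter which
   vertex is used here. *)
Definition form_cvg a j (u_ : nat -> E) (u : E) :=
  exists2 g, is_vertex a j g &
    vertex_seminorm a j g (u_ n - u) @[n --> \oo] --> (0 : R).

Definition linear_subspace (D : set E) :=
  D 0 /\ forall (c : C) x y, D x -> D y -> D (c *: x + y).

Definition is_core a j (D : set E) :=
  linear_subspace D /\
  exists2 g, is_vertex a j g &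
    forall u (e : R), 0 < e -> exists2 v, D v & vertex_seminorm a j g (u - v) < e.

Definition form_sip a j (x y : E) : C := re_form a x y + inner (j x) (j y).

Record form_completion a j := FormCompletion {
  compl_space : hilbertType R;
  compl_map : {linear E -> compl_space};
  compl_j : {linear compl_space -> H};
  compl_form : sesquiform R compl_space;
  compl_dense : dense (range compl_map);
  compl_sip : forall x y,
    form_sip a j x y = inner (compl_map x) (compl_map y);
  compl_j_continuous : continuous compl_j;
  compl_jE : forall x, compl_j (compl_map x) = j x;
  compl_form_continuous :
    continuous (fun p : compl_space * compl_space => compl_form p.1 p.2);
  compl_formE : forall x y, compl_form (compl_map x) (compl_map y) = a x y
}.

Definition completion_relation a j (K : form_completion a j) : set (H * H) :=
  [set xy | exists2 u : compl_space K, compl_j K u = xy.1 &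
     forall v, compl_form K u v = inner xy.2 (compl_j K v)].

(* Completions are unique up to isomorphism, so every completion gives the
   same relation. *)
Definition sectorial_relation a j : set (H * H) :=
  [set xy | exists K : form_completion a j, completion_relation K xy].

Definition shift_form a j g : E -> E -> C :=
  fun x y => a x y - toC g * inner (j x) (j y).

End Forms.

Definition shift_relation (H : lmodType C) (l : R) (B : set (H * H)) :
    set (H * H) :=
  [set (xy.1, xy.2 + toC l *: xy.1) | xy in B].

Definition inv_relation (H : Type) (B : set (H * H)) : set (H * H) :=
  [set (xy.2, xy.1) | xy in B].

(* The relation does not depend on the vertex used. *)
Definition associated_relation (H : hilbertType R) (E : lmodType C)
    (a : E -> E -> C) (j : E -> H) : set (H * H) :=
  [set xy | exists2 g, is_vertex a j g &
     shift_relation g (sectorial_relation (shift_form a j g) j) xy].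

(* [(l + B)^-1] is the graph of the bounded everywhere defined operator [T]. *)
Definition is_resolvent (H : hilbertType R) (B : set (H * H)) (l : R)
    (T : {linear H -> H}) :=
  continuous T /\
  inv_relation (shift_relation l B) = [set xy | xy.2 = T xy.1].

Definition resolvents_cvg (H : hilbertType R) (B_ : nat -> set (H * H))
    (B : set (H * H)) (l : R) :=
  exists (T_ : nat -> {linear H -> H}) (T : {linear H -> H}),
    [/\ forall n, is_resolvent (B_ n) l (T_ n), is_resolvent B l T
      & forall x, T_ n x @[n --> \oo] --> T x].

End Defs.

(* Main.v *)
Require Import Defs.
From HB Require Import structures.
From mathcomp Require Import all_boot all_order all_algebra.
From mathcomp Require Import complex.
From mathcomp Require Import all_classical all_reals all_analysis.
From mathcomp Require Import ring lra.

Set Implicit Arguments.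
Unset Strict Implicit.
Unset Printing Implicit Defensive.

Import Order.TTheory GRing.Theory Num.Theory.
Import numFieldNormedType.Exports.

Local Open Scope classical_set_scope.
Local Open Scope ring_scope.

(** Put [b = a + l (j | j)] and [b_n = a_n + l (j | j)]. For [l > - gamma] the
    real part of [b] is the square of a seminorm, the energy, equivalent to that of
    the form domain, and [b] is bounded and coercive for it.

    Everything is done on [dom a] itself with approximate solutions: [u] solves
    [b u = (x | j)] up to [e] when the difference of both functionals is at most
    [e] in the dual of the energy norm. The pair [(x, y)] belongs to the graph of
    [(l + A)^-1] exactly when for every [e > 0] there is such a [u] with
    [|j u - y| <= e] ([resolvent_graphE]). Coercivity makes this graph that of a
    bounded operator; approximate solutions exist by the Lax-Milgram lemma in the
    approximate form that holds on an incomplete space ([lax_milgram]). The completion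
    of the form domain is constructed only to compare this description with the
    definition of the associated relation: an element of the completion is
    replaced by nearby elements of the domain in one direction
    ([sectorial_relation_graph]), and a sequence of approximate solutions with
    [e] tending to [0] is replaced by its limit in the other one
    ([graph_sectorial_relation]). As the description mentions neither a vertex
    nor a completion, the relation is independent of their choice.

    The convergence is an error estimate of Cea-Strang type. Let [u] and [w] be
    approximate solutions for [b] and [b_n], let [v] be any element of
    [dom a_n], and let [z = w - v]. Up to the two residuals,
    [[
      b_n z z = b (u - v) z - (a_n - a) v z.
    ]]
    The real part of the left-hand side is the energy of [z] squared plus
    [Re (a_n - a) z z], and sectoriality bounds the right-hand side by a multiple
    of the square root of this quantity times the sum of the energy of [u - v]
    and the square root of [Re (a_n - a) v v]. So [z], hence [j w - j u], is
    small as soon as [v] is close to [u] and [Re (a_n - a) v v] is small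
    ([energy_error_bound]). Such [v] exist for large [n]: approximate [u] by an
    element of the core, and that element by the given sequence. *)

(** * Moduli of complex numbers and real-valued norms *)

Section ComplexModulus.
Variable R : realType.
Local Notation C := (Cx R).
Implicit Types (x y z : C) (r : R).

(** Norms over the complex field are themselves complex numbers; estimates are
    carried out with their real parts, where the order is total. *)
Definition rnorm (V : normedZmodType C) (v : V) : R := toRe `|v|.

Lemma toReD x y : toRe (x + y) = toRe x + toRe y.
Proof. by case: x; case: y. Qed.

Lemma toReN x : toRe (- x) = - toRe x.
Proof. by case: x. Qed.

Lemma toReB x y : toRe (x - y) = toRe x - toRe y.
Proof. by rewrite toReD toReN. Qed.

Lemma toReMl r x : toRe (toC r * x) = r * toRe x.
Proof. by case: x => a b; rewrite /toRe /toC /= mul0r subr0. Qed.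

Lemma toReK r : toRe (toC r) = r. Proof. by []. Qed.

Lemma toCD r s : toC (r + s) = toC r + toC s :> C.
Proof. by rewrite /toC rmorphD. Qed.

Lemma toCN r : toC (- r) = - toC r :> C.
Proof. by rewrite /toC rmorphN. Qed.

Lemma toCB r s : toC (r - s) = toC r - toC s :> C.
Proof. by rewrite toCD toCN. Qed.

Lemma toCM r s : toC (r * s) = toC r * toC s :> C.
Proof. by rewrite /toC rmorphM. Qed.

Lemma toC1 : toC 1 = 1 :> C.
Proof. by rewrite /toC rmorph1. Qed.

Lemma toRe_conj x : toRe x^* = toRe x.
Proof. by case: x. Qed.

Lemma toC_conj r : (toC r : C)^* = toC r.
Proof. exact: conjc_real. Qed.

Lemma ge0_toCE z : 0 <= z -> z = toC (toRe z).
Proof.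
by case: z => a b; rewrite lecE /= => /andP[/eqP b0 _]; rewrite /toC /toRe /= b0.
Qed.

Lemma toC_le r s : (toC r <= toC s :> C) = (r <= s).
Proof. by rewrite /toC lecR. Qed.

Lemma toC_lt r s : (toC r < toC s :> C) = (r < s).
Proof. by rewrite /toC ltcR. Qed.

Lemma rnormE (V : normedZmodType C) (v : V) : `|v| = toC (rnorm v).
Proof. exact/ge0_toCE/normr_ge0. Qed.

Lemma rnorm_ge0 (V : normedZmodType C) (v : V) : 0 <= rnorm v.
Proof. by rewrite -(toC_le 0) -rnormE; exact: normr_ge0. Qed.

Lemma rnormD (V : normedZmodType C) (u v : V) :
  rnorm (u + v) <= rnorm u + rnorm v.
Proof. by rewrite -toC_le toCD -!rnormE ler_normD. Qed.

Lemma rnormN (V : normedZmodType C) (v : V) : rnorm (- v) = rnorm v.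
Proof. by rewrite /rnorm normrN. Qed.

Lemma rnormBC (V : normedZmodType C) (u v : V) : rnorm (u - v) = rnorm (v - u).
Proof. by rewrite /rnorm distrC. Qed.

Lemma rnorm0 (V : normedZmodType C) : rnorm (0 : V) = 0.
Proof. by rewrite /rnorm normr0. Qed.

Lemma rnorm_eq0 (V : normedZmodType C) (v : V) : rnorm v = 0 -> v = 0.
Proof. by move=> v0; apply/normr0_eq0; rewrite rnormE v0. Qed.

Lemma rnormB (V : normedZmodType C) (u v : V) :
  rnorm (u - v) <= rnorm u + rnorm v.
Proof. by rewrite -(rnormN v) rnormD. Qed.

Lemma rnorm_dist (V : normedZmodType C) (u v : V) :
  `|rnorm u - rnorm v| <= rnorm (u - v).
Proof.
rewrite ler_norml; have := rnormD (u - v) v; rewrite subrK.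
have := rnormB u (u - v); rewrite subKr; lra.
Qed.

Lemma rnormZ (V : normedModType C) (c : C) (v : V) :
  rnorm (c *: v) = rnorm c * rnorm v.
Proof. by rewrite /rnorm normrZ rnormE toReMl. Qed.

Lemma rnormM x y : rnorm (x * y) = rnorm x * rnorm y.
Proof. by rewrite /rnorm normrM rnormE toReMl. Qed.

Lemma rnorm_conj x : rnorm x^* = rnorm x.
Proof. by rewrite /rnorm norm_conjC. Qed.

Lemma rnorm_toC r : rnorm (toC r : C) = `|r|.
Proof. 
by rewrite /rnorm /toC normc_def /= expr0n addr0 sqrtr_sqr.
Qed.

Lemma toRe_le x : `|toRe x| <= rnorm x.
Proof. by rewrite -toC_le -rnormE; exact: normc_ge_Re. Qed.

Lemma toRe_le_rnorm x : toRe x <= rnorm x.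
Proof. exact: le_trans (ler_norm _) (toRe_le x). Qed.

Lemma rnorm_phase z : exists2 w : C, rnorm w = 1 & toRe (w * z) = rnorm z.
Proof.
have [->|z0] := eqVneq z 0.
  by exists 1; rewrite ?mulr0 ?rnorm0 // /rnorm normr1.
exists (`|z| / z); last by rewrite mulfVK.
by rewrite /rnorm normrM normfV normr_id divff // normr_eq0.
Qed.

(** The hypothesis is strongest at [t = B / A], where it reads
    [2 m <= 2 k A B]; shifting [A] and [B] by a small [e] keeps this quotient
    meaningful when one of them vanishes. *)
Lemma scaling_bound (k m A B : R) : 0 <= k -> 0 <= A -> 0 <= B ->
  (forall t, 0 < t -> 2 * m <= k * (t * A ^+ 2 + t^-1 * B ^+ 2)) ->
  m <= k * (A * B).
Proof.
move=> k0 A0 B0 h; apply/ler_addgt0Pr => d d0.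
pose e := d / (k * (A + B) + 1).
have kAB : 0 <= k * (A + B) by rewrite mulr_ge0 // addr_ge0.
have e0 : 0 < e by rewrite divr_gt0 // ltr_wpDl.
have Ae : 0 < A + e by rewrite ltr_wpDl.
have Be : 0 < B + e by rewrite ltr_wpDl.
have := h ((B + e) / (A + e)) (divr_gt0 Be Ae); rewrite invf_div => {}h.
have h1 : (B + e) / (A + e) * A ^+ 2 <= (B + e) * A.
  rewrite expr2 mulrA ler_wpM2r // -mulrA ler_piMr ?(ltW Be) //.
  by rewrite mulrC ler_pdivrMr //; lra.
have h2 : (A + e) / (B + e) * B ^+ 2 <= (A + e) * B.
  rewrite expr2 mulrA ler_wpM2r // -mulrA ler_piMr ?(ltW Ae) //.
  by rewrite mulrC ler_pdivrMr //; lra.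
have h3 : 2 * m <= k * ((B + e) * A + (A + e) * B).
  by apply: le_trans h _; rewrite ler_wpM2l // lerD.
have h4 : k * (A + B) * e <= d.
  rewrite mulrC /e mulrAC ler_pdivrMr ?ltr_wpDl //; nra.
nra.
Qed.

End ComplexModulus.

Section SemiInnerProduct.
Variable R : realType.
Local Notation C := (Cx R).
Variable E : lmodType C.
Implicit Types (p b : E -> E -> C) (x y z : E) (c : C).

(** A predicate, since the forms below are built pointwise from one another. *)
Record sesquilinear b : Prop := Sesquilinear {
  sesqPl : forall c x y z, b (c *: x + y) z = c * b x z + b y z;
  sesqPr : forall c x y z, b z (c *: x + y) = c^* * b z x + b z y
}.

Section Sesquilinear.
Variables (b : E -> E -> C) (bP : sesquilinear b).

Lemma sesqDl x y z : b (x + y) z = b x z + b y z.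
Proof. by rewrite -[x]scale1r (sesqPl bP) mul1r scale1r. Qed.

Lemma sesqDr x y z : b z (x + y) = b z x + b z y.
Proof. by rewrite -[x]scale1r (sesqPr bP) rmorph1 mul1r scale1r. Qed.

Lemma sesq0l z : b 0 z = 0.
Proof. by apply: (addrI (b 0 z)); rewrite -sesqDl !addr0. Qed.

Lemma sesq0r z : b z 0 = 0.
Proof. by apply: (addrI (b z 0)); rewrite -sesqDr !addr0. Qed.

Lemma sesqZl c x z : b (c *: x) z = c * b x z.
Proof. by rewrite -[_ *: _]addr0 (sesqPl bP) sesq0l addr0. Qed.

Lemma sesqZr c x z : b z (c *: x) = c^* * b z x.
Proof. by rewrite -[_ *: _]addr0 (sesqPr bP) sesq0r addr0. Qed.

Lemma sesqNl x z : b (- x) z = - b x z.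
Proof. by rewrite -scaleN1r sesqZl mulN1r. Qed.

Lemma sesqNr x z : b z (- x) = - b z x.
Proof. by rewrite -scaleN1r sesqZr rmorphN1 mulN1r. Qed.

Lemma sesqBl x y z : b (x - y) z = b x z - b y z.
Proof. by rewrite sesqDl sesqNl. Qed.

Lemma sesqBr x y z : b z (x - y) = b z x - b z y.
Proof. by rewrite sesqDr sesqNr. Qed.

End Sesquilinear.

(** Degenerate vectors are allowed: the form domain carries only a seminorm. *)
Record semi_inner p : Prop := SemiInner {
  semi_inner_sesq : sesquilinear p;
  semi_inner_herm : forall x y, p y x = (p x y)^*;
  semi_inner_ge0 : forall x, 0 <= toRe (p x x)
}.

Definition seminorm p x : R := Num.sqrt (toRe (p x x)).

Section Seminorm.
Variables (p : E -> E -> C) (pP : semi_inner p).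
Let ps := semi_inner_sesq pP.
Local Notation N := (seminorm p).

Lemma seminorm_ge0 x : 0 <= N x.
Proof. exact: sqrtr_ge0. Qed.

Lemma sqr_seminorm x : N x ^+ 2 = toRe (p x x).
Proof. exact/sqr_sqrtr/semi_inner_ge0. Qed.

Lemma semi_inner_diag x : p x x = toC (N x ^+ 2).
Proof.
rewrite sqr_seminorm; apply: ge0_toCE; rewrite lecE /=.
have := semi_inner_herm pP x x; have := semi_inner_ge0 pP x; rewrite /toRe.
case: (p x x) => u v /= u0 [] /eqP; rewrite -addr_eq0.
by rewrite -mulr2n mulrn_eq0 /= => /eqP ->; rewrite u0 eqxx.
Qed.

Lemma seminormZ c x : N (c *: x) = rnorm c * N x.
Proof.
rewrite /seminorm (sesqZl ps) (sesqZr ps) mulrA -normCK rnormE expr2 -mulrA.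
rewrite !toReMl mulrA -expr2 sqrtrM ?sqr_ge0 // sqrtr_sqr.
by rewrite ger0_norm // rnorm_ge0.
Qed.

Lemma seminorm0 : N 0 = 0.
Proof. by rewrite /seminorm (sesq0l ps) /toRe /= sqrtr0. Qed.

Lemma seminormN x : N (- x) = N x.
Proof. by rewrite -scaleN1r seminormZ /rnorm normrN1 /toRe /= mul1r. Qed.

Lemma seminormBC x y : N (x - y) = N (y - x).
Proof. by rewrite -seminormN opprB. Qed.

Lemma sqr_seminormD x y :
  N (x + y) ^+ 2 = N x ^+ 2 + 2 * toRe (p x y) + N y ^+ 2.
Proof.
rewrite !sqr_seminorm !(sesqDl ps) !(sesqDr ps) (semi_inner_herm pP x y) !toReD.
rewrite toRe_conj; lra.
Qed.

Lemma cauchy_schwarz x y : rnorm (p x y) <= N x * N y.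
Proof.
rewrite -[_ * _]mul1r; apply: scaling_bound; rewrite ?ler01 ?sqrtr_ge0 // => t t0.
have [w w1 <-] := rnorm_phase (p x y).
have /= := sqr_ge0 (N ((- (toC t * w)) *: x + y)).
rewrite sqr_seminormD seminormZ rnormN rnormM w1 mulr1 rnorm_toC (gtr0_norm t0).
rewrite (sesqZl ps) mulNr toReN -mulrA toReMl => h.
rewrite mul1r -(ler_pM2l t0).
have -> : t * (t * N x ^+ 2 + t^-1 * N y ^+ 2) = (t * N x) ^+ 2 + N y ^+ 2.
  by field; rewrite gt_eqF.
lra.
Qed.

Lemma seminormD x y : N (x + y) <= N x + N y.
Proof.
rewrite -(@ler_pXn2r _ 2) ?nnegrE ?addr_ge0 ?seminorm_ge0 //.
rewrite sqr_seminormD.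
have := le_trans (toRe_le_rnorm _) (cauchy_schwarz x y); lra.
Qed.

(** Polarization: [b x y] is half the sum of [b x y + b y x] and
    [b x y - b y x]; the former is half the difference of the diagonal values at
    [x + y] and [x - y], and the latter becomes of this kind, up to the factor
    [i], when [y] is replaced by [i y]. Scaling [x] against [y] then
    turns the additive bound into a multiplicative one. *)
Lemma diag_bound b k : sesquilinear b -> 0 <= k ->
  (forall x, rnorm (b x x) <= k * N x ^+ 2) ->
  forall x y, rnorm (b x y) <= 2 * k * (N x * N y).
Proof.
move=> bP k0 bk.
have sym x y : rnorm (b x y + b y x) <= k * (N x ^+ 2 + N y ^+ 2).
  have h : 2 * rnorm (b x y + b y x) <=
      rnorm (b (x + y) (x + y)) + rnorm (b (x - y) (x - y)).
    rewrite -[2](@gtr0_norm R) // -rnorm_toC -rnormM.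
    apply: le_trans _ (rnormB _ _).
    rewrite !(sesqDl bP) !(sesqDr bP) !(sesqNl bP) !(sesqNr bP).
    rewrite [toC 2](_ : _ = 2); last by rewrite /toC rmorphMn.
    by rewrite le_eqVlt; apply/orP; left; apply/eqP; congr rnorm; ring.
  have hp := bk (x + y); have hm := bk (x - y).
  rewrite !sqr_seminormD seminormN (sesqNr ps) toReN in hp hm.
  nra.
have add x y : rnorm (b x y) <= k * (N x ^+ 2 + N y ^+ 2).
  have h1 := sym x y; have h2 := sym x ('i *: y).
  rewrite seminormZ (sesqZl bP) (sesqZr bP) conjCi in h2.
  rewrite [rnorm 'i](_ : _ = 1) in h2; last by rewrite /rnorm normCi.
  rewrite mul1r mulNr addrC -mulrBr rnormM in h2.
  rewrite [rnorm 'i](_ : _ = 1) in h2; last by rewrite /rnorm normCi.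
  rewrite mul1r in h2.
  have := rnormB (b x y + b y x) (b y x - b x y).
  rewrite [X in rnorm X](_ : _ = toC 2 * b x y); last first.
    by rewrite [toC 2](_ : _ = 2); [ring|rewrite /toC rmorphMn].
  rewrite rnormM rnorm_toC gtr0_norm //; lra.
move=> x y; apply: scaling_bound; rewrite ?mulr_ge0 ?seminorm_ge0 // => t t0.
have := add (toC t *: x) y.
rewrite (sesqZl bP) seminormZ rnormM rnorm_toC gtr0_norm // exprMn => h.
rewrite -(ler_pM2l t0).
have -> : t * (2 * k * (t * N x ^+ 2 + t^-1 * N y ^+ 2)) =
  2 * (k * (t ^+ 2 * N x ^+ 2 + N y ^+ 2)).
  by field; rewrite gt_eqF.
lra.
Qed.

End Seminorm.

End SemiInnerProduct.

(** * Approximate Lax-Milgram in a semi-inner product space *)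

Section LaxMilgram.
Variable R : realType.
Local Notation C := (Cx R).
Variable E : lmodType C.
Implicit Types (p b : E -> E -> C) (phi : E -> C) (x y z u : E).

Definition antilinear phi :=
  forall (c : C) x y, phi (c *: x + y) = c^* * phi x + phi y.

(** The dual norm of the residual [b u - phi] is at most [e]. *)
Definition residual_le p b phi (e : R) u :=
  forall z, rnorm (b u z - phi z) <= e * seminorm p z.

(** Solvability up to arbitrarily small residuals is what exact solvability in
    the completion becomes on a space that is not complete. *)
Definition solvable p b := forall phi (M : R), antilinear phi ->
  (forall z, rnorm (phi z) <= M * seminorm p z) ->
  forall e, 0 < e -> exists u, residual_le p b phi e u.

Variables (p : E -> E -> C) (pP : semi_inner p).
Let ps := semi_inner_sesq pP.
Local Notation N := (seminorm p).

Lemma antilinearZ phi (c : C) z : antilinear phi -> phi (c *: z) = c^* * phi z.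
Proof.
move=> phiP; have phi0 : phi 0 = 0.
  apply: (addrI (phi 0)).
  by have := phiP 1 0 0; rewrite rmorph1 mul1r scale1r !addr0.
by have := phiP c z 0; rewrite phi0 !addr0.
Qed.

Lemma antilinearN phi z : antilinear phi -> phi (- z) = - phi z.
Proof. by move=> phiP; rewrite -scaleN1r antilinearZ // rmorphN1 mulN1r. Qed.

Lemma antilinearD phi x y : antilinear phi -> phi (x + y) = phi x + phi y.
Proof.
by move=> phiP; have := phiP 1 x y; rewrite scale1r rmorph1 mul1r.
Qed.

(** Riesz representation: at an almost minimizer [v] of
    [|v|^2 - 2 Re (phi v)] the functional cannot decrease along any direction by
    more than the defect [e^2], which bounds its derivative [p v - phi]. *)
Lemma solvable_inner : solvable p p.
Proof.
move=> phi M phiP phiM e e0.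
pose J v : R := N v ^+ 2 - 2 * toRe (phi v).
have Jlb : has_lbound (range J).
  exists (- M ^+ 2) => _ [v _ <-]; rewrite /J.
  have := le_trans (toRe_le_rnorm (phi v)) (phiM v).
  have := sqr_ge0 (N v - M); nra.
have Jinf : has_inf (range J) by split; first by exists (J 0), 0.
have [_ [v _ <-] vJ] := inf_adherent (exprn_gt0 2 e0) Jinf.
exists v => z; rewrite mulrC -[_ * _]mul1r.
apply: scaling_bound; rewrite ?ler01 ?seminorm_ge0 ?(ltW e0) // => t t0.
have [w w1 wE] := rnorm_phase (p v z - phi z).
(* The direction in which the functional decreases fastest. *)
pose c : C := toC t * w^*.
have := ge_inf Jlb (imageT J (v - c *: z)); rewrite {2}/J.
rewrite sqr_seminormD // seminormN // (antilinearD _ _ phiP) (antilinearN _ phiP).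
rewrite (sesqNr ps) (sesqZr ps) (antilinearZ _ _ phiP) seminormZ //.
rewrite rmorphM /= conjCK toC_conj rnormM rnorm_conj w1 mulr1 rnorm_toC.
rewrite gtr0_norm // toReD !toReN -!mulrA !toReMl => h.
have {}h : 2 * (t * toRe (w * (p v z - phi z))) <= (t * N z) ^+ 2 + e ^+ 2.
  by rewrite mulrBr toReB; move: vJ h; rewrite {1}/J; lra.
rewrite mul1r -(ler_pM2l t0).
have -> : t * (t * N z ^+ 2 + t^-1 * e ^+ 2) = (t * N z) ^+ 2 + e ^+ 2.
  by field; rewrite gt_eqF.
by rewrite wE in h; lra.
Qed.

Lemma residual_antilinear b phi u : sesquilinear b -> antilinear phi ->
  antilinear (fun z => phi z - b u z).
Proof. by move=> bP phiP c x y; rewrite phiP (sesqPr bP); ring. Qed.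

Lemma coercive_bound b phi M e u :
  (forall v, N v ^+ 2 <= toRe (b v v)) ->
  (forall z, rnorm (phi z) <= M * N z) -> 0 <= M -> 0 <= e ->
  residual_le p b phi e u -> N u <= M + e.
Proof.
move=> bc phiM M0 e0 ru.
have [Nu0|Nu0] := leP (N u) 0; first by apply: le_trans Nu0 _; rewrite addr_ge0.
rewrite -(ler_pM2l Nu0) -expr2; apply: le_trans (bc u) _.
apply: le_trans (toRe_le_rnorm _) _.
rewrite -[b u u](subrK (phi u)); apply: le_trans (rnormD _ _) _.
have := phiM u; have := ru u; lra.
Qed.

(** Solving with [b] leaves the residual [d u], and [d u] has norm at most
    [kappa] times that of the right-hand side; so repeated correction decreases
    the residual for [b + d] geometrically. *)
Lemma solvable_perturb b b' d kappa :
  sesquilinear b' ->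
  (forall v, N v ^+ 2 <= toRe (b v v)) ->
  (forall x y, b' x y = b x y + d x y) ->
  0 <= kappa < 1 -> (forall x y, rnorm (d x y) <= kappa * (N x * N y)) ->
  solvable p b -> solvable p b'.
Proof.
move=> b'P bc b'E /andP[k0 k1] dk bsol.
pose k' := (1 + kappa) / 2.
have step phi M : antilinear phi -> (forall z, rnorm (phi z) <= M * N z) ->
    0 < M -> exists u, residual_le p b' phi (k' * M) u.
  move=> phiP phiM M0; pose e := (1 - kappa) / 4 * M.
  have e0 : 0 < e by rewrite mulr_gt0 // divr_gt0 // subr_gt0.
  have [u ru] := bsol phi M phiP phiM e e0.
  exists u => z; rewrite b'E addrAC.
  apply: le_trans (rnormD _ _) _.
  have Nu := coercive_bound bc phiM (ltW M0) (ltW e0) ru.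
  have Nz := seminorm_ge0 p z.
  have h : kappa * (N u * N z) <= kappa * ((M + e) * N z).
    by rewrite ler_wpM2l // ler_wpM2r.
  apply: le_trans (lerD (ru z) (le_trans (dk u z) h)) _.
  rewrite mulrA -mulrDl ler_wpM2r // /k' /e.
  have : 0 <= (1 - kappa) ^+ 2 * M by rewrite mulr_ge0 ?sqr_ge0 // ltW.
  lra.
move=> phi M phiP phiM e e0.
have k'0 : 0 <= k' by rewrite divr_ge0 // addr_ge0.
pose M' := `|M| + 1; have M'0 : 0 < M' by rewrite ltr_wpDl.
have phiM' z : rnorm (phi z) <= M' * N z.
  apply: le_trans (phiM z) _; rewrite ler_wpM2r ?seminorm_ge0 //.
  by rewrite /M'; have := ler_norm M; lra.
have k'gt0 : 0 < k' by rewrite divr_gt0 // ltr_wpDr.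
have iter n : exists u, residual_le p b' phi (k' ^+ n * M') u.
  elim: n => [|n [u ru]].
    exists 0 => z; rewrite (sesq0l b'P) sub0r rnormN expr0 mul1r; exact: phiM'.
  have [|||v rv] := step (fun z => phi z - b' u z) (k' ^+ n * M').
  - exact: residual_antilinear.
  - by move=> z; rewrite rnormBC; exact: ru.
  - by rewrite mulr_gt0 // exprn_gt0.
  exists (v + u) => z; rewrite (sesqDl b'P).
  have := rv z; rewrite exprS -mulrA; congr (rnorm _ <= _); ring.
have k'1 : `|k'| < 1 by rewrite ger0_norm // /k'; lra.
have /cvgr0Pnorm_lt/(_ (e / M') (divr_gt0 e0 M'0)) [n _ hn] := cvg_expr k'1.
have [u ru] := iter n; exists u => z; apply: le_trans (ru z) _.
rewrite ler_wpM2r ?seminorm_ge0 // -ler_pdivlMr //.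
exact: le_trans (ler_norm _) (ltW (hn n (leqnn n))).
Qed.

End LaxMilgram.

Section LaxMilgramForm.
Variable R : realType.
Local Notation C := (Cx R).
Variable E : lmodType C.
Variables (b : E -> E -> C) (bP : sesquilinear b).

Lemma re_form_diag x : toRe (re_form b x x) = toRe (b x x).
Proof.
rewrite /re_form [2^-1](_ : _ = toC 2^-1) ?toReMl ?toReD ?toRe_conj; first lra.
by rewrite /toC fmorphV rmorphMn.
Qed.

Lemma semi_inner_re_form : (forall x, 0 <= toRe (b x x)) ->
  semi_inner (re_form b).
Proof.
move=> b0; split=> [|x y|x]; last by rewrite re_form_diag.
  split=> c x y z; rewrite /re_form (sesqPl bP) (sesqPr bP) rmorphD rmorphM /=.
    by rewrite conjCK; ring.
  ring.
by rewrite /re_form rmorphM rmorphD /= conjCK fmorphV rmorphMn rmorph1 addrC.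
Qed.

(** Lax-Milgram by continuation: [b] is its real part, which is the inner
    product itself, plus a skew part; the skew part is switched on in steps so
    short that each is a perturbation of norm less than one. *)
Lemma lax_milgram K : (forall x, 0 <= toRe (b x x)) ->
  (forall x y, rnorm (b x y) <=
     K * (seminorm (re_form b) x * seminorm (re_form b) y)) ->
  solvable (re_form b) b.
Proof.
move=> b0 bK; have pP := semi_inner_re_form b0.
pose p := re_form b; pose N := seminorm p.
have ps : sesquilinear p := semi_inner_sesq pP.
have N0 x : 0 <= N x by exact: seminorm_ge0.
pose h x y : C := 2^-1 * (b x y - (b y x)^*).
have hP : sesquilinear h.
  split=> c x y z; rewrite /h (sesqPl bP) (sesqPr bP) rmorphD rmorphM /=.
    by rewrite conjCK; ring.
  ring.
have half : 2^-1 = toC (2^-1) :> C by rewrite /toC fmorphV rmorphMn.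
have hRe x : toRe (h x x) = 0.
  by rewrite /h half toReMl toReB toRe_conj; lra.
pose K' := `|K|.
have hK x y : rnorm (h x y) <= K' * (N x * N y).
  rewrite /h half rnormM rnorm_toC ger0_norm ?invr_ge0 //.
  have h1 := rnormB (b x y) (b y x)^*; rewrite rnorm_conj in h1.
  have h2 := bK x y; have h3 := bK y x.
  have h4 : K * (N x * N y) <= K' * (N x * N y).
    by rewrite ler_wpM2r ?mulr_ge0 // ler_norm.
  rewrite /N /p in h4 *; lra.
(* The number of steps makes the increment [s * h] smaller than one. *)
pose n := Num.trunc K'; pose s : R := n.+1%:R^-1.
have s0 : 0 < s by rewrite invr_gt0 ltr0n.
have sK : 0 <= s * K' < 1.
  rewrite mulr_ge0 ?normr_ge0 ?(ltW s0) //= mulrC ltr_pdivrMr ?ltr0n // mul1r.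
  by have /andP[] := Num.Theory.trunc_itv (normr_ge0 K).
pose bk (k : nat) x y : C := p x y + toC (k%:R * s) * h x y.
have bkP k : sesquilinear (bk k).
  split=> c x y z; rewrite /bk ?(sesqPl ps) ?(sesqPr ps) ?(sesqPl hP) ?(sesqPr hP).
    ring.
  ring.
have bk_sol k : solvable p (bk k).
  elim: k => [|k IH].
    have -> : bk 0%N = p.
      by apply/funext => x; apply/funext => y; rewrite /bk !mul0r addr0.
    exact: solvable_inner.
  apply: (@solvable_perturb _ _ p (bk k) _ (fun x y => toC s * h x y) (s * K')) => //.
  - by move=> v; rewrite /bk toReD toReMl hRe mulr0 addr0 /N sqr_seminorm.
  - move=> x y; rewrite /bk -addrA -mulrDl -toCD.
    by congr (_ + toC _ * _); rewrite -natr1; ring.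
  - move=> x y; rewrite rnormM rnorm_toC gtr0_norm // -mulrA.
    by rewrite ler_wpM2l // ltW.
have := bk_sol n.+1; congr (solvable p _); apply/funext => x; apply/funext => y.
rewrite /bk /s divff ?pnatr_eq0 // [toC 1]toC1 mul1r /p /re_form /h.
by field.
Qed.

End LaxMilgramForm.

(** * Limits with real radii *)

Section Tends.
Variable R : realType.
Local Notation C := (Cx R).

Definition tends (V : normedZmodType C) (u : nat -> V) (l : V) :=
  forall e : R, 0 < e -> \forall n \near \oo, rnorm (u n - l) < e.

Section TendsZmod.
Variable V : normedZmodType C.
Implicit Types (u v : nat -> V) (l : V).

Lemma tends_cst l : tends (fun=> l) l.
Proof.
by move=> e e0; near=> n; rewrite subrr rnorm0.
Unshelve. all: by end_near. Qed.

Lemma tendsD u v l m : tends u l -> tends v m -> tends (fun n => u n + v n) (l + m).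
Proof.
move=> ul vm e e0; have e20 : 0 < e / 2 by rewrite divr_gt0.
apply: filterS2 (ul _ e20) (vm _ e20) => n un vn.
rewrite opprD addrACA; apply: le_lt_trans (rnormD _ _) _; lra.
Qed.

Lemma tendsN u l : tends u l -> tends (fun n => - u n) (- l).
Proof.
move=> ul e e0; apply: filterS (ul _ e0) => n.
by rewrite -opprD rnormN.
Qed.

Lemma tendsB u v l m : tends u l -> tends v m -> tends (fun n => u n - v n) (l - m).
Proof. by move=> ul /tendsN; exact: tendsD. Qed.

Lemma tends_le u l (K : R) : tends u l ->
  (\forall n \near \oo, rnorm (u n) <= K) -> rnorm l <= K.
Proof.
move=> ul uK; apply/ler_addgt0Pr => e e0.
have [n [un un']] := filter_ex (filterI uK (ul _ e0)).
by have := rnormB (u n) (u n - l); rewrite subKr; lra.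
Qed.

Lemma tends_uniq u l m : tends u l -> tends u m -> l = m.
Proof.
move=> ul um; apply/subr0_eq/rnorm_eq0/eqP; rewrite eq_le rnorm_ge0 andbT.
apply: tends_le (tendsB ul um) _.
by near=> n; rewrite subrr rnorm0. Unshelve. all: by end_near.
Qed.

Lemma tends_near u v l : tends u l -> tends (fun n => v n - u n) 0 -> tends v l.
Proof.
move=> ul vu; have := tendsD vu ul; rewrite add0r => h e e0.
by apply: filterS (h e e0) => n; rewrite subrK.
Qed.

(** Limits are chosen through opaque proofs, which keeps conversion from
    unfolding them. *)
Lemma tends_lim_exists u : exists l, (exists l', tends u l') -> tends u l.
Proof.
have [[l ul]|ul] := pselect (exists l, tends u l); first by exists l.
by exists 0.
Qed.

Definition tends_lim u : V := sval (cid (tends_lim_exists u)).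

Lemma tends_limP u : (exists l, tends u l) -> tends u (tends_lim u).
Proof. exact: svalP (cid (tends_lim_exists u)). Qed.

End TendsZmod.

Lemma tendsZl (V : normedModType C) (c : C) (u : nat -> V) l :
  tends u l -> tends (fun n => c *: u n) (c *: l).
Proof.
move=> ul e e0; have c0 : 0 < rnorm c + 1 by rewrite ltr_wpDl ?rnorm_ge0.
apply: filterS (ul (e / (rnorm c + 1)) (divr_gt0 e0 c0)) => n.
rewrite ltr_pdivlMr // -scalerBr rnormZ.
have := rnorm_ge0 (u n - l); lra.
Qed.

Lemma tendsMl (c : C) (u : nat -> C) l :
  tends u l -> tends (fun n => c * u n) (c * l).
Proof.
move=> ul e e0; have c0 : 0 < rnorm c + 1 by rewrite ltr_wpDl ?rnorm_ge0.
apply: filterS (ul (e / (rnorm c + 1)) (divr_gt0 e0 c0)) => n.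
rewrite ltr_pdivlMr // -mulrBr rnormM.
have := rnorm_ge0 (u n - l); lra.
Qed.

Lemma tends_conj (u : nat -> C) l : tends u l -> tends (fun n => (u n)^*) l^*.
Proof.
by move=> ul e e0; apply: filterS (ul e e0) => n; rewrite -rmorphB rnorm_conj.
Qed.

Lemma tends_Re (u : nat -> C) l :
  tends u l -> toRe (u n) @[n --> \oo] --> toRe l.
Proof.
move=> ul; apply/cvgrPdist_lt => e e0; apply: filterS (ul e e0) => n.
by apply: le_lt_trans; rewrite distrC -toReB toRe_le.
Qed.

Lemma toC_gt0 (e : C) : 0 < e -> exists2 r : R, 0 < r & e = toC r.
Proof.
move=> e0; exists (toRe e); last exact/ge0_toCE/ltW.
by rewrite -toC_lt -ge0_toCE // ltW.
Qed.

Lemma cvg_tends (V : normedModType C) (u : nat -> V) l :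
  u @ \oo --> l <-> tends u l.
Proof.
split=> [/cvgrPdist_lt ul e e0|ul].
  have e0' : (0 : C) < toC e by rewrite (toC_lt 0).
  by apply: filterS (ul _ e0') => n; rewrite rnormE toC_lt rnormBC.
apply/cvgrPdist_lt => _ /toC_gt0[e e0 ->].
by apply: filterS (ul _ e0) => n; rewrite rnormBC rnormE toC_lt.
Qed.

Lemma invS_small (e : R) : 0 < e ->
  exists k, forall n, (k <= n)%N -> n.+1%:R^-1 < e.
Proof.
move=> e0; have := near_infty_natSinv_lt (PosNum e0) => -[k _ hk].
by exists k => n kn; exact: hk.
Qed.

Definition cauchy_for (T : Type) (d : T -> T -> R) (u : nat -> T) :=
  forall e : R, 0 < e -> exists k, forall m n, (k <= m)%N -> (k <= n)%N ->
    d (u m) (u n) < e.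

Lemma cauchy_tends (V : completeNormedModType C) (u : nat -> V) :
  cauchy_for (fun x y => rnorm (x - y)) u -> exists l, tends u l.
Proof.
move=> cu; suff /cauchy_cvgP/cvg_ex[l /cvg_tends ul] : cauchy (u @ \oo).
  by exists l.
apply: cauchy_exP => _ /toC_gt0[e e0 ->].
have [k hk] := cu e e0; exists (u k); exists k => // n /= kn.
by rewrite -ball_normE /ball_ /= rnormE toC_lt hk.
Qed.

Lemma cauchy_tendsR (u : nat -> R) :
  cauchy_for (fun x y => `|x - y|) u -> exists l : R, u @ \oo --> l.
Proof.
move=> cu; suff /cauchy_cvgP/cvg_ex[l ul] : cauchy (u @ \oo) by exists l.
apply: cauchy_exP => e e0.
have [k hk] := cu e e0; exists (u k); exists k => // n /= kn.
by rewrite -ball_normE /ball_ /= hk.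
Qed.

Definition toIm (z : C) : R := complex.Im z.

Lemma rnorm_ReIm (z : C) : rnorm z <= `|toRe z| + `|toIm z|.
Proof.
case: z => a b; rewrite -(toC_le (rnorm _)) -rnormE normc_def /= /toRe /toIm /=.
rewrite /toC lecR -(@ler_pXn2r _ 2) ?nnegrE ?addr_ge0 ?sqrtr_ge0 //.
rewrite sqr_sqrtr ?addr_ge0 ?sqr_ge0 // sqrrD !real_normK ?num_real //.
by rewrite lerD2r lerDl mulrn_wge0 // mulr_ge0.
Qed.

Lemma toIm_le (z : C) : `|toIm z| <= rnorm z.
Proof.
case: z => a b; rewrite -(toC_le `|_|) -rnormE normc_def /= /toIm /=.
by rewrite /toC lecR -sqrtr_sqr ler_sqrt ?addr_ge0 ?sqr_ge0 // lerDr sqr_ge0.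
Qed.

Lemma toImB (x y : C) : toIm (x - y) = toIm x - toIm y.
Proof. by case: x; case: y. Qed.

Lemma cauchy_tendsC (u : nat -> C) :
  cauchy_for (fun x y => rnorm (x - y)) u -> exists l, tends u l.
Proof.
move=> cu.
have [a ua] : exists a : R, toRe (u n) @[n --> \oo] --> a.
  apply: cauchy_tendsR => e /cu[k hk]; exists k => m n km kn.
  by rewrite -toReB (le_lt_trans (toRe_le _)) // hk.
have [b ub] : exists b : R, toIm (u n) @[n --> \oo] --> b.
  apply: cauchy_tendsR => e /cu[k hk]; exists k => m n km kn.
  by rewrite -toImB (le_lt_trans (toIm_le _)) // hk.
exists (Complex a b) => e e0; have e20 : 0 < e / 2 by rewrite divr_gt0.
move/cvgrPdist_lt/(_ _ e20) in ua; move/cvgrPdist_lt/(_ _ e20) in ub.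
apply: filterS2 ua ub => n un vn.
apply: le_lt_trans (rnorm_ReIm _) _; rewrite toReB toImB.
by rewrite [e]splitr ltrD // [X in X < _](distrC _ _).
Qed.

End Tends.

(** * The Hilbert completion of a semi-inner product space *)

Section Completion.
Variable R : realType.
Local Notation C := (Cx R).

Record sip_space (E : lmodType C) := SipSpace {
  sip_form :> E -> E -> C;
  sip_space_semi_inner : semi_inner sip_form
}.

Variables (E : lmodType C) (p : sip_space E).
Let pP := sip_space_semi_inner p.
Let ps := semi_inner_sesq pP.
Local Notation N := (seminorm p).
Implicit Types (s t : nat -> E) (x y z : E).

Definition sip_cauchy s := cauchy_for (fun x y => N (x - y)) s.

Lemma cauchy_comb (c : C) s t : sip_cauchy s -> sip_cauchy t ->
  sip_cauchy (fun n => c *: s n + t n).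
Proof.
move=> cs ct e e0; have c0 : 0 < rnorm c + 1 by rewrite ltr_wpDl ?rnorm_ge0.
have e1 : 0 < e / 2 / (rnorm c + 1) by rewrite !divr_gt0.
have e2 : 0 < e / 2 by rewrite divr_gt0.
have [k hk] := cs _ e1; have [l hl] := ct _ e2.
exists (maxn k l) => m n; rewrite !geq_max => /andP[km lm] /andP[kn ln].
rewrite opprD addrACA -scalerBr; apply: le_lt_trans (seminormD pP _ _) _.
have := hk m n km kn; rewrite ltr_pdivlMr // seminormZ // => h.
have := hl m n lm ln; have := seminorm_ge0 p (s m - s n); lra.
Qed.

Lemma cauchy_cst x : sip_cauchy (fun=> x).
Proof. by move=> e e0; exists 0%N => m n _ _; rewrite subrr seminorm0. Qed.

Lemma cauchy_bounded s : sip_cauchy s -> exists2 K, 0 < K &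
  \forall n \near \oo, N (s n) <= K.
Proof.
move=> /(_ 1 ltr01)[k hk]; exists (N (s k) + 1).
  by rewrite ltr_wpDl ?seminorm_ge0.
exists k => // n /= kn; rewrite -[s n](subrK (s k)) addrC.
by apply: le_trans (seminormD pP _ _) _; rewrite lerD2l ltW // hk.
Qed.

Definition bounded_form (b : E -> E -> C) :=
  exists2 K, 0 <= K & forall x y, rnorm (b x y) <= K * (N x * N y).

Lemma bounded_cauchy_tends b s t : sesquilinear b -> bounded_form b ->
  sip_cauchy s -> sip_cauchy t -> exists l, tends (fun n => b (s n) (t n)) l.
Proof.
move=> bP [K K0 bK] cs ct; apply: cauchy_tendsC => e e0.
have [A A0 [ka _ hA]] := cauchy_bounded cs.
have [B B0 [kb _ hB]] := cauchy_bounded ct.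
have D0 : 0 < K * (A + B) + 1 by rewrite ltr_wpDl // mulr_ge0 // addr_ge0 // ltW.
have d0 := divr_gt0 e0 D0.
have [k hk] := cs _ d0; have [l hl] := ct _ d0.
exists (maxn (maxn ka kb) (maxn k l)) => m n.
rewrite !geq_max => /andP[/andP[am bm] /andP[km lm]].
move=> /andP[/andP[an bn] /andP[kn ln]].
have -> : b (s m) (t m) - b (s n) (t n) =
    b (s m - s n) (t m) + b (s n) (t m - t n).
  by rewrite (sesqBl bP) (sesqBr bP); ring.
apply: le_lt_trans (rnormD _ _) _.
have h1 : rnorm (b (s m - s n) (t m)) <= K * (e / (K * (A + B) + 1) * B).
  apply: le_trans (bK _ _) _; rewrite ler_wpM2l // ler_pM ?seminorm_ge0 //.
    by rewrite ltW // hk.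
  exact: hB.
have h2 : rnorm (b (s n) (t m - t n)) <= K * (A * (e / (K * (A + B) + 1))).
  apply: le_trans (bK _ _) _; rewrite ler_wpM2l // ler_pM ?seminorm_ge0 //.
    exact: hA.
  by rewrite ltW // hl.
apply: le_lt_trans (lerD h1 h2) _.
set d := e / _ in d0 *.
have -> : e = d * (K * (A + B) + 1) by rewrite /d divfK ?gt_eqF.
lra.
Qed.

(** A point of the completion is realized as a functional on [E], namely
    [z |-> lim p (s n) z] for a Cauchy sequence [s]; sequences with the same limit
    are thereby identified without a quotient. *)
Definition represents s (f : E -> C) :=
  sip_cauchy s /\ forall z, tends (fun n => p (s n) z) (f z).

Record completion := CompletionPoint {
  functional : E -> C;
  functional_rep : exists s, represents s functional
}.

HB.instance Definition _ := gen_eqMixin completion.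
HB.instance Definition _ := gen_choiceMixin completion.

Lemma completion_eq (f g : completion) : functional f =1 functional g -> f = g.
Proof.
case: f g => [f fP] [g gP] /= /funext fg; rewrite fg in fP *.
by congr CompletionPoint; exact: Prop_irrelevance.
Qed.

Lemma represents_comb (c : C) s t f g : represents s f -> represents t g ->
  represents (fun n => c *: s n + t n) (fun z => c * f z + g z).
Proof.
move=> [cs sf] [ct tg]; split=> [|z]; first exact: cauchy_comb.
have := tendsD (tendsMl c (sf z)) (tg z).
by under eq_fun do rewrite -(sesqPl ps).
Qed.

Lemma represents0 : represents (fun=> 0) (fun=> 0).
Proof.
split=> [|z]; first exact: cauchy_cst.
by under eq_fun do rewrite (sesq0l ps); exact: tends_cst.
Qed.

(** The operations of the completion are chosen from opaque existence proofs:
    transparent ones make unification compare representing sequences. *)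
Lemma comb_exists (c : C) (f g : completion) : exists h : completion,
  functional h = fun z => c * functional f z + functional g z.
Proof.
have [s sf] := functional_rep f; have [t tg] := functional_rep g.
have h := represents_comb c sf tg.
by exists (CompletionPoint (ex_intro (represents^~ _) _ h)).
Qed.

Definition completion_comb (c : C) (f g : completion) : completion :=
  sval (cid (comb_exists c f g)).

Lemma completion_combE (c : C) f g z :
  functional (completion_comb c f g) z = c * functional f z + functional g z.
Proof. by rewrite (svalP (cid (comb_exists c f g))). Qed.

Lemma zero_exists : exists f : completion, functional f = fun=> 0.
Proof.
by exists (CompletionPoint (ex_intro (represents^~ _) _ represents0)).
Qed.

Definition completion0 : completion := sval (cid zero_exists).

Lemma completion0E z : functional completion0 z = 0.
Proof. by rewrite (svalP (cid zero_exists)). Qed.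

Definition completionE := (completion_combE, completion0E).

Definition completion_add (f g : completion) := completion_comb 1 f g.
Definition completion_opp (f : completion) := completion_comb (-1) f completion0.
Definition completion_scale (c : C) (f : completion) :=
  completion_comb c f completion0.

Lemma completion_addA : associative completion_add.
Proof. by move=> f g h; apply: completion_eq => z; rewrite !completionE !mul1r addrA. Qed.

Lemma completion_addC : commutative completion_add.
Proof. by move=> f g; apply: completion_eq => z; rewrite !completionE !mul1r addrC. Qed.

Lemma completion_add0 : left_id completion0 completion_add.
Proof. by move=> f; apply: completion_eq => z; rewrite !completionE mulr0 add0r. Qed.

Lemma completion_addN : left_inverse completion0 completion_opp completion_add.
Proof.
by move=> f; apply: completion_eq => z; rewrite !completionE mul1r addr0 mulN1r addNr.
Qed.

HB.instance Definition _ := GRing.isZmodule.Build completion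
  completion_addA completion_addC completion_add0 completion_addN.

Lemma completion_scaleA (c d : C) f :
  completion_scale c (completion_scale d f) = completion_scale (c * d) f.
Proof. by apply: completion_eq => z; rewrite !completionE !addr0 mulrA. Qed.

Lemma completion_scale1 : left_id 1 completion_scale.
Proof. by move=> f; apply: completion_eq => z; rewrite !completionE addr0 mul1r. Qed.

Lemma completion_scaleDr : right_distributive completion_scale completion_add.
Proof.
by move=> c f g; apply: completion_eq => z; rewrite !completionE !addr0 !mul1r mulrDr.
Qed.

Lemma completion_scaleDl f :
  {morph completion_scale^~ f : c d / c + d >-> completion_add c d}.
Proof.
by move=> c d; apply: completion_eq => z; rewrite !completionE !addr0 mul1r mulrDl.
Qed.

HB.instance Definition _ := GRing.Zmodule_isLmodule.Build C completion
  completion_scaleA completion_scale1 completion_scaleDr completion_scaleDl.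

Lemma functionalP (c : C) (f g : completion) :
  functional (c *: f + g) = fun z => c * functional f z + functional g z.
Proof. by apply/funext => z; rewrite !completionE mul1r addr0. Qed.

Lemma functional0 : functional 0 = fun=> 0.
Proof. by apply/funext => z; exact: completion0E. Qed.

Definition rep_seq (f : completion) : nat -> E := sval (cid (functional_rep f)).

Lemma rep_seqP f : represents (rep_seq f) (functional f).
Proof. exact: svalP (cid (functional_rep f)). Qed.

End Completion.

Section Extension.
Variable R : realType.
Local Notation C := (Cx R).
Variables (E : lmodType C) (p : sip_space E).
Let pP := sip_space_semi_inner p.
Let ps := semi_inner_sesq pP.
Local Notation N := (seminorm p).
Implicit Types (s t : nat -> E) (x y z : E) (f g : completion p).

Definition converges s f := represents p s (functional f).

Lemma converges_comb (c : C) s t f g : converges s f -> converges t g ->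
  converges (fun n => c *: s n + t n) (c *: f + g).
Proof.
move=> sf tg; rewrite /converges functionalP.
exact: represents_comb.
Qed.

Lemma converges_uniq s f g : converges s f -> converges s g -> f = g.
Proof.
move=> [_ sf] [_ sg]; apply: completion_eq => z.
exact: tends_uniq (sf z) (sg z).
Qed.

Lemma bounded_inner : bounded_form p p.
Proof. by exists 1 => // x y; rewrite mul1r cauchy_schwarz. Qed.

Lemma cauchy_converges s : sip_cauchy p s -> exists f, converges s f.
Proof.
move=> cs.
have lim z : exists l : C, tends (fun n => p (s n) z) l.
  exact: (bounded_cauchy_tends ps bounded_inner cs (cauchy_cst p z)).
pose f z : C := sval (cid (lim z)).
have sf : represents p s f by split=> // z; exact: svalP (cid (lim z)).
by exists (CompletionPoint (ex_intro ((represents p)^~ _) s sf)).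
Qed.

(** Weak and strong null sequences agree among Cauchy sequences: split
    [|s n|^2 = p (s n) (s n - s k) + p (s n) (s k)], where the first term is
    small for large [k] and the second one for fixed [k] and large [n]. *)
Lemma represents0_null s : represents p s (fun=> 0) ->
  forall e, 0 < e -> \forall n \near \oo, N (s n) < e.
Proof.
move=> [cs s0] e e0; have [A A0 hA] := cauchy_bounded cs.
have d0 : 0 < e ^+ 2 / 2 by rewrite divr_gt0 ?exprn_gt0.
have [k hk] := cs _ (divr_gt0 d0 A0).
have nk : \forall n \near \oo, (k <= n)%N by exists k.
apply: filterS3 hA nk (s0 (s k) _ d0) => n nA kn; rewrite subr0 => h.
rewrite -(@ltr_pXn2r _ 2) ?nnegrE ?seminorm_ge0 ?(ltW e0) // sqr_seminorm //.
rewrite -{2}[s n](subrK (s k)) (sesqDr ps) toReD.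
apply: le_lt_trans (lerD (toRe_le_rnorm _) (toRe_le_rnorm _)) _.
rewrite [e ^+ 2]splitr; apply: ler_ltD h.
apply: le_trans (cauchy_schwarz pP _ _) _.
have := ltW (hk n k kn (leqnn k)); rewrite ler_pdivlMr // => h1.
apply: le_trans h1; rewrite mulrC ler_wpM2l ?seminorm_ge0 //.
Qed.

Lemma converges_diff s t f : converges s f -> converges t f ->
  forall e, 0 < e -> \forall n \near \oo, N (s n - t n) < e.
Proof.
move=> sf tf; apply: represents0_null.
have := represents_comb (-1) tf sf.
under [X in represents _ X _]eq_fun do rewrite scaleN1r addrC.
by under [X in represents _ _ X]eq_fun do rewrite mulN1r addNr.
Qed.

Definition extend_form (b : E -> E -> C) f g : C :=
  tends_lim (fun n => b (rep_seq f n) (rep_seq g n)).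

Definition embed x : completion p := sval (cid (cauchy_converges (cauchy_cst p x))).

Lemma embed_converges x : converges (fun=> x) (embed x).
Proof. exact: svalP (cid (cauchy_converges _)). Qed.

Lemma embed_linear : linear embed.
Proof.
move=> c x y; apply: converges_uniq (embed_converges _) _.
exact: converges_comb (embed_converges x) (embed_converges y).
Qed.

HB.instance Definition _ :=
  GRing.isLinear.Build C E (completion p) *:%R embed embed_linear.

Section Form.
Variables (b : E -> E -> C) (bP : sesquilinear b) (bb : bounded_form p b).

Lemma extend_formP s t f g : converges s f -> converges t g ->
  tends (fun n => b (s n) (t n)) (extend_form b f g).
Proof.
move=> sf tg; set s' := rep_seq f; set t' := rep_seq g.
have sf' : converges s' f := rep_seqP f.
have tg' : converges t' g := rep_seqP g.
have h : tends (fun n => b (s' n) (t' n)) (extend_form b f g).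
  exact: tends_limP (bounded_cauchy_tends bP bb sf'.1 tg'.1).
apply: tends_near h _ => e e0; have [K K0 bK] := bb.
have [A A0 hA] := cauchy_bounded sf'.1; have [B B0 hB] := cauchy_bounded tg.1.
have D0 : 0 < K * (A + B) + 1 by rewrite ltr_wpDl // mulr_ge0 // addr_ge0 // ltW.
have d0 := divr_gt0 e0 D0.
apply: filterS2 (filterI hA hB)
  (filterI (converges_diff sf sf' d0) (converges_diff tg tg' d0)).
move=> n [nA nB] [ns nt].
have -> : b (s n) (t n) - b (s' n) (t' n) - 0 =
    b (s n - s' n) (t n) + b (s' n) (t n - t' n).
  by rewrite (sesqBl bP) (sesqBr bP); ring.
apply: le_lt_trans (rnormD _ _) _.
have h1 := ler_wpM2l K0 (ler_pM (seminorm_ge0 p _) (seminorm_ge0 p _) (ltW ns) nB).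
have h2 := ler_wpM2l K0 (ler_pM (seminorm_ge0 p _) (seminorm_ge0 p _) nA (ltW nt)).
apply: le_lt_trans (lerD (le_trans (bK _ _) h1) (le_trans (bK _ _) h2)) _.
set d := e / _ in d0 *.
have -> : e = d * (K * (A + B) + 1) by rewrite /d divfK ?gt_eqF.
lra.
Qed.

Lemma extend_form_sesq : sesquilinear (extend_form b).
Proof.
split=> c f g h; have fP := rep_seqP f; have gP := rep_seqP g; have hP := rep_seqP h.
  have := extend_formP (converges_comb c fP gP) hP.
  under eq_fun do rewrite (sesqPl bP).
  move/tends_uniq; apply.
  exact: tendsD (tendsMl _ (extend_formP fP hP)) (extend_formP gP hP).
have := extend_formP hP (converges_comb c fP gP).
under eq_fun do rewrite (sesqPr bP).
move/tends_uniq; apply.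
exact: tendsD (tendsMl _ (extend_formP hP fP)) (extend_formP hP gP).
Qed.

Lemma extend_form_embed x y : extend_form b (embed x) (embed y) = b x y.
Proof.
exact: tends_uniq (extend_formP (embed_converges x) (embed_converges y))
  (tends_cst _).
Qed.

End Form.

Definition completion_inner f g : C := extend_form p f g.

Lemma completion_innerP : semi_inner completion_inner.
Proof.
have bp := bounded_inner; split=> [|f g|f]; first exact: extend_form_sesq.
  have h := extend_formP ps bp (rep_seqP f) (rep_seqP g).
  apply: tends_uniq (extend_formP ps bp (rep_seqP g) (rep_seqP f)) _.
  by under eq_fun do rewrite (semi_inner_herm pP); exact: tends_conj.
have /tends_Re h := extend_formP ps bp (rep_seqP f) (rep_seqP f).
by apply: cvgr_to_ge h _; near=> n; exact: semi_inner_ge0.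
Unshelve. all: by end_near. Qed.

Lemma completion_norm_embed x : seminorm completion_inner (embed x) = N x.
Proof.
by rewrite /seminorm /completion_inner extend_form_embed //; exact: bounded_inner.
Qed.

Lemma completion_norm_le s f K : converges s f -> 0 <= K ->
  (\forall n \near \oo, N (s n) <= K) -> seminorm completion_inner f <= K.
Proof.
move=> sf K0 sK; rewrite -(@ler_pXn2r _ 2) ?nnegrE ?seminorm_ge0 //.
rewrite (sqr_seminorm completion_innerP).
have /tends_Re h := extend_formP ps bounded_inner sf sf.
apply: cvgr_to_le h _; apply: filterS sK => n nK.
by rewrite -sqr_seminorm // ler_pXn2r ?nnegrE ?seminorm_ge0.
Qed.

Lemma converges_near s f : converges s f -> forall e, 0 < e ->
  \forall n \near \oo, seminorm completion_inner (f - embed (s n)) < e.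
Proof.
move=> sf e e0; have e20 : 0 < e / 2 by rewrite divr_gt0.
have [k hk] := sf.1 _ e20; exists k => // m /= km.
apply: (@le_lt_trans _ _ (e / 2)); last lra.
have h := converges_comb (-1) (embed_converges (s m)) sf.
rewrite !scaleN1r [- embed _ + _]addrC in h.
apply: (completion_norm_le h (ltW e20)).
by exists k => // n /= kn; rewrite addrC ltW // hk.
Qed.

Lemma completion_norm_eq0 f : seminorm completion_inner f = 0 -> f = 0.
Proof.
move=> f0; have fP := rep_seqP f.
have /tends_Re := extend_formP ps bounded_inner fP fP.
rewrite -/(completion_inner f f) -(sqr_seminorm completion_innerP) f0 expr0n /=.
move=> h; apply: (converges_uniq fP); split=> [|z]; first exact: fP.1.
move=> e e0; have z1 : 0 < N z + 1 by rewrite ltr_wpDl ?seminorm_ge0.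
have d0 := divr_gt0 e0 z1.
move/cvgr0Pnorm_lt/(_ _ (exprn_gt0 2 d0)) : h; apply: filterS => n.
rewrite -sqr_seminorm // ger0_norm ?sqr_ge0 //.
rewrite ltr_pXn2r ?nnegrE ?seminorm_ge0 ?(ltW d0) // ltr_pdivlMr // => h.
rewrite functional0 subr0.
apply: le_lt_trans (cauchy_schwarz pP _ _) (le_lt_trans _ h).
by rewrite ler_wpM2l ?seminorm_ge0 // lerDl.
Qed.

End Extension.

Section Bundling.
Variable R : realType.
Local Notation C := (Cx R).

Definition bundle_linear (U V : lmodType C) (f : U -> V) (fP : linear f) :
    {linear U -> V} :=
  HB.pack f (GRing.isLinear.Build C U V *:%R f fP).

Definition bundle_sesquiform (V : lmodType C) (b : V -> V -> C)
    (bP : sesquilinear b) : sesquiform R V :=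
  HB.pack b (isBilinear.Build C V V C *%R (@Num.conj C \; *%R) b
    (fun z x y => sesqBl bP x y z) (fun z x y => sesqBr bP x y z)
    (fun z c x => sesqZl bP c x z) (fun z c x => sesqZr bP c x z)).

Lemma sesquiform_sesq (V : lmodType C) (b : sesquiform R V) : sesquilinear b.
Proof. by split=> c x y z; rewrite (linearPl, linearPr). Qed.

End Bundling.

Section HilbertCompletion.
Variable R : realType.
Local Notation C := (Cx R).
Variables (E : lmodType C) (p : sip_space E).
Let pP := sip_space_semi_inner p.
Implicit Types f g : completion p.
Local Notation ip := (@completion_inner R E p).
Local Notation nrm := (seminorm ip).
Let ipP : semi_inner ip := completion_innerP p.

Lemma completion_ler_normD f g : toC (nrm (f + g)) <= toC (nrm f) + toC (nrm g) :> C.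
Proof. by rewrite -toCD toC_le seminormD. Qed.

Lemma completion_normrZ (c : C) f : toC (nrm (c *: f)) = `|c| * toC (nrm f).
Proof. by rewrite seminormZ // toCM -rnormE. Qed.

Lemma completion_normr0_eq0 f : toC (nrm f) = 0 :> C -> f = 0.
Proof. by move=> [f0]; exact: completion_norm_eq0. Qed.

HB.instance Definition _ := @Lmodule_isNormed.Build C (completion p)
  (fun f => toC (nrm f)) completion_ler_normD completion_normrZ
  completion_normr0_eq0.

Lemma completion_rnormE f : rnorm f = nrm f.
Proof. by []. Qed.

Lemma embed_dense f (e : R) : 0 < e -> exists x, rnorm (f - embed p x) < e.
Proof.
move=> e0; have [n hn] := filter_ex (converges_near (rep_seqP f) e0).
by exists (rep_seq f n).
Qed.

Lemma ballE f g (e : R) : ball f (toC e) g <-> rnorm (f - g) < e.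
Proof. by rewrite -ball_normE /ball_ /= rnormE toC_lt. Qed.

(** Completeness for filters follows from that for sequences in [E]: points
    within [1 / n] of the filter form a Cauchy sequence, and the filter converges
    to the element that it represents. *)
Lemma completion_complete (F : set_system (completion p)) :
  ProperFilter F -> cauchy F -> cvg F.
Proof.
move=> FF cF; pose e_ n : R := n.+1%:R^-1.
have e_gt0 n : 0 < e_ n by rewrite invr_gt0 ltr0n.
have appr n : exists x, F [set g | rnorm (embed p x - g) < e_ n].
  have e0 : (0 : C) < toC (e_ n / 2) by rewrite (toC_lt 0) divr_gt0.
  have [f Ff] := (cauchyP F).1 cF _ e0.
  have [x fx] := embed_dense f (divr_gt0 (e_gt0 n) (ltr0n _ 2)).
  exists x; apply: filterS Ff => g /ballE fg.
  rewrite [e_ n]splitr /= -(subrK f (embed p x)) -addrA.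
  apply: le_lt_trans (rnormD _ _) _; apply: ltrD; last exact: fg.
  by rewrite rnormBC; exact: fx.
pose s n := sval (cid (appr n)).
have sF n : F [set g | rnorm (embed p (s n) - g) < e_ n] := svalP (cid (appr n)).
have cs : sip_cauchy p s.
  move=> e e0; have [k hk] := invS_small (divr_gt0 e0 (ltr0n _ 2)).
  exists k => m n km kn.
  have [g [gm gn]] := filter_ex (filterI (sF m) (sF n)).
  rewrite -completion_norm_embed -completion_rnormE linearB /=.
  rewrite -(subrK g (embed p (s m))) -addrA [e]splitr.
  apply: le_lt_trans (rnormD _ _) _; apply: ltrD.
    exact: lt_trans gm (hk m km).
  by rewrite rnormBC; exact: lt_trans gn (hk n kn).
have [f sf] := cauchy_converges cs.
apply/cvg_ex; exists f; apply/cvgrPdist_lt => _ /toC_gt0[e e0 ->].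
have e20 : 0 < e / 2 by rewrite divr_gt0.
have [k hk] := invS_small e20.
have nk : \forall n \near \oo, (k <= n)%N by exists k.
have [n [fn kn]] := filter_ex (filterI (converges_near sf e20) nk).
near=> g; rewrite rnormE toC_lt -(subrK (embed p (s n)) f) -addrA [e]splitr.
apply: le_lt_trans (rnormD _ _) _; apply: ltrD; first by rewrite completion_rnormE.
apply: lt_trans (hk n kn); near: g; exact: sF.
Unshelve. all: by end_near. Qed.

HB.instance Definition _ := Uniform_isComplete.Build (completion p) completion_complete.

Let ips := semi_inner_sesq ipP.

HB.instance Definition _ := isBilinear.Build C (completion p) (completion p) C
  *%R (@Num.conj C \; *%R) ip
  (fun z x y => sesqBl ips x y z) (fun z x y => sesqBr ips x y z)
  (fun z c x => sesqZl ips c x z) (fun z c x => sesqZr ips c x z).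

Lemma completion_hermitian f g : ip f g = (-1) ^+ false * (ip g f)^*.
Proof. by rewrite expr0 mul1r (semi_inner_herm ipP). Qed.

HB.instance Definition _ := isHermitianSesquilinear.Build C (completion p)
  false (@Num.conj C) ip completion_hermitian.

Lemma completion_inner_gt0 f : f != 0 -> 0 < ip f f.
Proof.
move=> f0; rewrite (semi_inner_diag ipP) (toC_lt 0) lt_def sqr_ge0 andbT sqrf_eq0.
by apply: contra_neq f0; exact: completion_norm_eq0.
Qed.

HB.instance Definition _ := isDotProduct.Build C (completion p) ip completion_inner_gt0.

Lemma completion_inner_norm f : ip f f = `|f| ^+ 2.
Proof. by rewrite (semi_inner_diag ipP) expr2 toCM -expr2. Qed.

HB.instance Definition _ :=
  isHilbert.Build R (completion p) completion_inner_norm.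

End HilbertCompletion.

(** * Bounded linear maps and forms *)

Section BoundedMaps.
Variable R : realType.
Local Notation C := (Cx R).

Lemma linear_bound_continuous (V W : normedModType C) (f : {linear V -> W})
    (K : R) : (forall v, rnorm (f v) <= K * rnorm v) -> continuous f.
Proof.
move=> fK x; apply/cvgrPdist_lt => _ /toC_gt0[e e0 ->].
have K0 : 0 < `|K| + 1 by rewrite ltr_wpDl.
have d0 : (0 : C) < toC (e / (`|K| + 1)) by rewrite (toC_lt 0) divr_gt0.
apply/nbhs_ballP; exists (toC (e / (`|K| + 1))) => //= y.
rewrite -ball_normE /ball_ /= -linearB !rnormE !toC_lt ltr_pdivlMr // => xy.
apply: le_lt_trans (fK _) (le_lt_trans _ xy).
rewrite mulrC ler_wpM2l ?rnorm_ge0 //; have := ler_norm K; lra.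
Qed.

Lemma form_bound_continuous (V : normedModType C) (b : V -> V -> C) (K : R) :
  sesquilinear b -> (forall u v, rnorm (b u v) <= K * (rnorm u * rnorm v)) ->
  continuous (fun q : V * V => b q.1 q.2).
Proof.
move=> bP bK [x y]; apply/cvgrPdist_lt => _ /toC_gt0[e e0 ->] /=.
pose L := `|K| * (rnorm x + rnorm y + 1) + 1.
have L0 : 0 < L by rewrite ltr_wpDl // mulr_ge0 // !addr_ge0 ?rnorm_ge0.
pose d := Num.min 1 (e / L).
have d0 : 0 < d by rewrite lt_min ltr01 divr_gt0.
have dC : (0 : C) < toC d by rewrite (toC_lt 0).
have dL : d * L <= e by rewrite -ler_pdivlMr // ge_min lexx orbT.
have d1 : d <= 1 by rewrite ge_min lexx.
exists (ball x (toC d), ball y (toC d)) => /=.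
  by split; exact: nbhsx_ballx.
move=> q; rewrite -!ball_normE /ball_ /= !rnormE !toC_lt => -[h1 h2].
have -> : b x y - b q.1 q.2 = b (x - q.1) y + b q.1 (y - q.2).
  by rewrite (sesqBl bP) (sesqBr bP); ring.
apply: le_lt_trans (rnormD _ _) _.
have bK' u v : rnorm (b u v) <= `|K| * (rnorm u * rnorm v).
  apply: le_trans (bK u v) _.
  by rewrite ler_wpM2r ?ler_norm // mulr_ge0 ?rnorm_ge0.
have q1 : rnorm q.1 <= rnorm x + 1.
  have := rnormB x (x - q.1); rewrite subKr; lra.
have e1 : rnorm (b (x - q.1) y) <= `|K| * (d * rnorm y).
  apply: le_trans (bK' _ _) _; rewrite ler_wpM2l // ler_wpM2r ?rnorm_ge0 //.
  exact: ltW.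
have e2 : rnorm (b q.1 (y - q.2)) <= `|K| * ((rnorm x + 1) * d).
  apply: le_trans (bK' _ _) _; rewrite ler_wpM2l // ler_pM ?rnorm_ge0 //.
  exact: ltW.
apply: le_lt_trans (lerD e1 e2) _; apply: lt_le_trans dL.
rewrite /L; nra.
Qed.

Lemma continuous_linear_bound (V W : normedModType C) (f : {linear V -> W}) :
  continuous f -> exists2 K : R, 0 <= K & forall v, rnorm (f v) <= K * rnorm v.
Proof.
move=> fc; have : f x @[x --> (0 : V)] --> (0 : W) by rewrite -(linear0 f); exact: fc.
have C1 : (0 : C) < toC 1 by rewrite (toC_lt 0).
move=> /cvgr0Pnorm_lt/(_ _ C1); rewrite -nbhs_ballE => -[_ /= /toC_gt0[d d0 ->] hd].
exists (2 / d) => [|v]; first by rewrite divr_ge0 // ltW.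
have small w : rnorm w < d -> rnorm (f w) <= 1.
  move=> wd; apply: ltW; rewrite -toC_lt -rnormE; apply: hd.
  by rewrite /= -ball_normE /ball_ /= sub0r normrN rnormE toC_lt.
have [v0|v0] := eqVneq (rnorm v) 0.
  by rewrite (rnorm_eq0 v0) linear0 !rnorm0 mulr0.
have vp : 0 < rnorm v by rewrite lt_def v0 rnorm_ge0.
have r0 : 0 < d / 2 / rnorm v by rewrite !divr_gt0.
have := small (toC (d / 2 / rnorm v) *: v).
rewrite linearZ !rnormZ rnorm_toC gtr0_norm // divfK ?gt_eqF //.
have -> : d / 2 < d by lra.
move=> /(_ isT).
have -> : 2 / d * rnorm v = 1 / (d / 2 / rnorm v) by field; rewrite v0 gt_eqF.
by rewrite ler_pdivlMr // mulrC.
Qed.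

Lemma continuous_form_bound (V : normedModType C) (b : V -> V -> C) :
  sesquilinear b -> continuous (fun q : V * V => b q.1 q.2) ->
  exists2 K : R, 0 <= K & forall u v, rnorm (b u v) <= K * (rnorm u * rnorm v).
Proof.
move=> bP bc.
have b0 : b q.1 q.2 @[q --> ((0, 0) : V * V)] --> b 0 0 := bc (0, 0).
rewrite (sesq0l bP) in b0.
have C1 : (0 : C) < toC 1 by rewrite (toC_lt 0).
move/cvgr0Pnorm_lt/(_ _ C1) : b0 => -[[A B] /= [/nbhs_ballP[_ /toC_gt0[r r0 ->] rA]
  /nbhs_ballP[_ /toC_gt0[t t0 ->] tB]] hAB].
pose d := Num.min r t; have d0 : 0 < d by rewrite lt_min r0.
exists ((2 / d) ^+ 2) => [|u v]; first exact: sqr_ge0.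
have small x y : rnorm x < d -> rnorm y < d -> rnorm (b x y) <= 1.
  rewrite !lt_min => /andP[xr _] /andP[_ yt].
  apply: ltW; rewrite -toC_lt -rnormE; apply: (hAB (x, y)); split.
    by apply: rA; rewrite -ball_normE /ball_ /= sub0r normrN rnormE toC_lt.
  by apply: tB; rewrite -ball_normE /ball_ /= sub0r normrN rnormE toC_lt.
have [u0|u0] := eqVneq (rnorm u) 0.
  by rewrite (rnorm_eq0 u0) (sesq0l bP) !rnorm0 mul0r mulr0.
have [v0|v0] := eqVneq (rnorm v) 0.
  by rewrite (rnorm_eq0 v0) (sesq0r bP) !rnorm0 !mulr0.
have up : 0 < rnorm u by rewrite lt_def u0 rnorm_ge0.
have vp : 0 < rnorm v by rewrite lt_def v0 rnorm_ge0.
have ru : 0 < d / 2 / rnorm u by rewrite !divr_gt0.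
have rv : 0 < d / 2 / rnorm v by rewrite !divr_gt0.
have := small (toC (d / 2 / rnorm u) *: u) (toC (d / 2 / rnorm v) *: v).
rewrite (sesqZl bP) (sesqZr bP) toC_conj !rnormM !rnormZ !rnorm_toC !gtr0_norm //.
rewrite !divfK ?gt_eqF //; have -> : d / 2 < d by lra.
move=> /(_ isT isT); rewrite mulrA.
have -> : (2 / d) ^+ 2 * (rnorm u * rnorm v) =
    1 / (d / 2 / rnorm u * (d / 2 / rnorm v)).
  by field; rewrite ?u0 ?v0 ?gt_eqF.
by rewrite ler_pdivlMr ?(mulr_gt0 ru rv) // => h; rewrite mulrC.
Qed.

End BoundedMaps.

(** * The completion of a form *)

Section ExtendToCompletion.
Variable R : realType.
Local Notation C := (Cx R).
Variables (E : lmodType C) (p : sip_space E).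
Let pP := sip_space_semi_inner p.
Local Notation N := (seminorm p).
Implicit Types (s t : nat -> E) (f g : completion p).

Lemma converges_norm s f : converges s f -> N (s n) @[n --> \oo] --> rnorm f.
Proof.
move=> sf; apply/cvgrPdist_lt => e e0.
apply: filterS (converges_near sf e0) => n.
rewrite -completion_rnormE -completion_norm_embed -completion_rnormE.
exact: le_lt_trans (rnorm_dist _ _).
Qed.

Lemma tends_le_cvg (V : normedZmodType C) (u : nat -> V) l (r : nat -> R) r0 :
  tends u l -> r @ \oo --> r0 -> (forall n, rnorm (u n) <= r n) -> rnorm l <= r0.
Proof.
move=> ul rr h; apply/ler_addgt0Pr => e e0.
apply: (tends_le ul); move/cvgrPdist_lt/(_ _ e0) : rr; apply: filterS => n.
rewrite ltr_norml => /andP[h1 _]; apply: le_trans (h n) _; lra.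
Qed.

Lemma extend_form_bound b K : sesquilinear b -> 0 <= K ->
  (forall x y, rnorm (b x y) <= K * (N x * N y)) ->
  forall f g, rnorm (extend_form b f g) <= K * (rnorm f * rnorm g).
Proof.
move=> bP K0 bK f g; have bb : bounded_form p b by exists K.
have fP := rep_seqP f; have gP := rep_seqP g.
apply: (tends_le_cvg (extend_formP bP bb fP gP) _ (fun n => bK _ _)).
exact: cvgMr (cvgM (converges_norm fP) (converges_norm gP)).
Qed.

Variables (H : completeNormedModType C) (j : {linear E -> H}) (c : R).
Hypotheses (c_ge0 : 0 <= c) (jc : forall x, rnorm (j x) <= c * N x).

Definition extend_map f : H := tends_lim (fun n => j (rep_seq f n)).

Lemma extend_mapP s f : converges s f -> tends (fun n => j (s n)) (extend_map f).
Proof.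
have c1 : 0 < c + 1 by rewrite ltr_wpDl.
have jc1 x e : N x < e / (c + 1) -> rnorm (j x) < e.
  rewrite ltr_pdivlMr // => xe; apply: le_lt_trans (jc x) (le_lt_trans _ xe).
  by have := seminorm_ge0 p x; lra.
move=> sf; have fP := rep_seqP f.
have h : tends (fun n => j (rep_seq f n)) (extend_map f).
  apply: tends_limP; apply: cauchy_tends => e e0.
  have [k hk] := fP.1 _ (divr_gt0 e0 c1); exists k => m n km kn.
  by rewrite -linearB jc1 // hk.
apply: (tends_near h) => e e0.
apply: filterS (converges_diff sf fP (divr_gt0 e0 c1)) => n.
by rewrite subr0 -linearB; exact: jc1.
Qed.

Lemma extend_map_linear : linear extend_map.
Proof.
move=> a f g; have fP := rep_seqP f; have gP := rep_seqP g.
have := extend_mapP (converges_comb a fP gP).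
under eq_fun do rewrite linearP.
move/tends_uniq; apply.
exact: tendsD (tendsZl _ (extend_mapP fP)) (extend_mapP gP).
Qed.

Lemma extend_map_bound f : rnorm (extend_map f) <= c * rnorm f.
Proof.
have fP := rep_seqP f.
apply: (tends_le_cvg (extend_mapP fP) _ (fun n => jc _)).
exact: cvgMr (converges_norm fP).
Qed.

Lemma extend_map_embed x : extend_map (embed p x) = j x.
Proof. exact: tends_uniq (extend_mapP (embed_converges p x)) (tends_cst _). Qed.

End ExtendToCompletion.

Section FormCompletion.
Variable R : realType.
Local Notation C := (Cx R).
Variables (H : hilbertType R) (E : lmodType C) (a : E -> E -> C).
Variables (j : {linear E -> H}).
Hypotheses (aP : sesquilinear a) (pP : semi_inner (form_sip a j)).
Let p := SipSpace pP.
Local Notation N := (seminorm (form_sip a j)).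
Variable K : R.
Hypotheses (K_ge0 : 0 <= K) (aK : forall x y, rnorm (a x y) <= K * (N x * N y)).
Hypothesis j1 : forall x, rnorm (j x) <= N x.

Lemma form_completion_exists : inhabited (form_completion a j).
Proof.
have ab : bounded_form p a by exists K.
have j1' x : rnorm (j x) <= 1 * seminorm p x by rewrite mul1r.
pose J := bundle_linear (extend_map_linear ler01 j1').
pose A := bundle_sesquiform (extend_form_sesq aP ab).
have dense_embed : dense (range (embed p)).
  move=> O [f Of] Oo; have /nbhs_ballP[_ /toC_gt0[e e0 ->] eO] : nbhs f O.
    exact: open_nbhs_nbhs.
  have [x xe] := embed_dense f e0.
  exists (embed p x); split; last by exists x.
  by apply: eO; rewrite -ball_normE /ball_ /= rnormE toC_lt.
have sipE x y : form_sip a j x y = inner (embed p x) (embed p y).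
  exact: esym (extend_form_embed (semi_inner_sesq pP) (bounded_inner p) x y).
have Jc : continuous J.
  exact: (@linear_bound_continuous _ _ _ J 1 (extend_map_bound ler01 j1')).
have Jemb x : J (embed p x) = j x by exact: extend_map_embed.
have Ac : continuous (fun q : completion p * completion p => A q.1 q.2).
  apply: (@form_bound_continuous _ (completion p) A K).
    exact: extend_form_sesq.
  exact: extend_form_bound.
have Aemb x y : A (embed p x) (embed p y) = a x y by exact: extend_form_embed.
exact: inhabits (@FormCompletion _ _ _ a j (completion p : hilbertType R)
  (embed p) J A dense_embed sipE Jc Jemb Ac Aemb).
Qed.

End FormCompletion.

(** * Sectors *)

Section Sector.
Variable R : realType.
Local Notation C := (Cx R).

Lemma closure_rnorm (A : set C) (z : C) :
  closure A z <-> forall e : R, 0 < e -> exists2 w, A w & rnorm (z - w) < e.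
Proof.
split=> [Az e e0|Az B /nbhs_ballP[_ /toC_gt0[e e0 ->] eB]].
  have [|w [Aw zw]] := Az (ball z (toC e)).
    by apply: nbhsx_ballx; rewrite (toC_lt 0).
  by exists w => //; move: zw; rewrite -ball_normE /ball_ /= rnormE toC_lt.
have [w Aw zw] := Az e e0; exists w; split => //; apply: eB.
by rewrite -ball_normE /ball_ /= rnormE toC_lt.
Qed.

Lemma cos_angle_gt0 (theta : R) : is_angle theta -> 0 < cos theta.
Proof.
move=> /andP[t0 t1]; apply: cos_gt0_pihalf; rewrite t1 andbT.
by apply: lt_le_trans t0; rewrite oppr_lt0 divr_gt0 // pi_gt0.
Qed.

Lemma rnorm_polar (r alpha : R) : 0 <= r ->
  rnorm (Complex (r * cos alpha) (r * sin alpha) : C) = r.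
Proof.
move=> r0; rewrite /rnorm normc_def /toRe /= !exprMn -mulrDr cos2Dsin2 mulr1.
by rewrite sqrtr_sqr ger0_norm.
Qed.

(** Sectoriality enters the proof only through the inequality
    [|z| <= M Re z], with [M = 1 / cos theta] on the sector. *)
Lemma closure_sector_bound (theta : R) : is_angle theta ->
  exists2 M : R, 1 <= M &
    forall z, closure (sector theta) z -> rnorm z <= M * toRe z.
Proof.
move=> ht; have c0 := cos_angle_gt0 ht; have /andP[t0 t1] := ht.
have pi0 := pi_gt0 R.
have M1 : 1 <= (cos theta)^-1 by rewrite invf_ge1 // cos_le1.
exists (cos theta)^-1 => // z /closure_rnorm hz; apply/ler_addgt0Pr => e e0.
have d0 : 0 < e / (1 + (cos theta)^-1).
  by rewrite divr_gt0 // addr_gt0 // invr_gt0.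
have [w [r [alpha [r0 ha wE]]] zw] := hz _ d0.
have hw : rnorm w <= (cos theta)^-1 * toRe w.
  rewrite wE rnorm_polar ?(ltW r0) // /toRe /= mulrCA ler_pMr //.
  rewrite mulrC ler_pdivlMr // mul1r.
  case: ha => [/andP[h1 h2]|->]; last by rewrite cos0 cos_le1.
  wlog a0 : alpha h1 h2 {wE} / 0 <= alpha => [hwlog|].
    have [/hwlog|/ltW na] := leP 0 alpha; first exact.
    by rewrite -[cos alpha]cosN; apply: hwlog; rewrite ?oppr_ge0 //; lra.
  have [->|nt] := eqVneq alpha theta; first exact: lexx.
  by apply: ltW; rewrite ltr_cos // in_itv /=; lra.
rewrite ltr_pdivlMr ?addr_gt0 ?invr_gt0 // mulrDr mulr1 in zw.
have h1 : rnorm z <= rnorm (z - w) + rnorm w.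
  by have := rnormD (z - w) w; rewrite subrK.
have h2 : toRe w <= toRe z + rnorm (z - w).
  have := toRe_le_rnorm (w - z); rewrite toReB rnormBC; lra.
have h3 : (cos theta)^-1 * toRe w <= (cos theta)^-1 * (toRe z + rnorm (z - w)).
  by rewrite ler_wpM2l // invr_ge0 ltW.
lra.
Qed.

(** An angle larger than the optimal [acos (1 / M)] puts every such nonzero [z]
    into the open sector, where its polar coordinates are a witness. *)
Lemma bound_closure_sector (M : R) : 1 <= M -> exists2 theta, is_angle theta &
  forall z : C, rnorm z <= M * toRe z -> closure (sector theta) z.
Proof.
move=> M1; have M0 : 0 < M by lra.
have c0 : 0 < (2 * M)^-1 by rewrite invr_gt0 mulr_gt0.
have c1 : (2 * M)^-1 < 1 by rewrite invf_lt1 ?mulr_gt0 //; lra.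
have cI : -1 <= (2 * M)^-1 <= 1 by lra.
pose theta := acos (2 * M)^-1.
have t0 : 0 <= theta by exact: acos_ge0.
have tpi : theta <= pi by exact: acos_lepi.
have pi0 := pi_gt0 R.
have tE : cos theta = (2 * M)^-1 by exact: acosK.
have t1 : theta < pi / 2.
  rewrite -ltr_cos ?in_itv /=; last 2 first.
  - by rewrite t0.
  - lra.
  by rewrite cos_pihalf tE.
exists theta => [|z zM]; first by rewrite /is_angle t0.
have [z0|z0] := eqVneq z 0.
  apply/closure_rnorm => e e0.
  have r0 : 0 < e / 2 by rewrite divr_gt0.
  exists (Complex (e / 2 * cos 0) (e / 2 * sin 0)); last first.
    by rewrite z0 sub0r rnormN rnorm_polar ?(ltW r0) //; lra.
  by exists (e / 2), 0; split => //; right.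
apply: subset_closure.
have r0 : 0 < rnorm z.
  by rewrite lt_def rnorm_ge0 andbT; apply: contra_neq z0; exact: rnorm_eq0.
pose q := toRe z / rnorm z.
have q1 : q <= 1 by rewrite ler_pdivrMr // mul1r toRe_le_rnorm.
have qM : (2 * M)^-1 < q.
  rewrite ltr_pdivlMr // mulrC ltr_pdivrMr ?mulr_gt0 //; nra.
have qI : -1 <= q <= 1 by lra.
have a0 : 0 <= acos q by exact: acos_ge0.
have at1 : acos q < theta.
  rewrite -ltr_cos ?in_itv /= ?t0 ?a0 ?acos_lepi //.
  by rewrite tE acosK.
have sE : rnorm z * sin (acos q) = `|toIm z|.
  have nE : rnorm z ^+ 2 = toRe z ^+ 2 + toIm z ^+ 2.
    case: z {zM z0 r0 q q1 qM qI a0 at1} => a b.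
    by rewrite /rnorm normc_def /toRe /toIm /= sqr_sqrtr ?addr_ge0 ?sqr_ge0.
  rewrite sin_acos // -[X in X * _]ger0_norm ?(ltW r0) // -sqrtr_sqr -sqrtrM ?sqr_ge0 //.
  rewrite -sqrtr_sqr mulrBr mulr1 /q expr_div_n mulrC divfK ?sqrf_eq0 ?gt_eqF //.
  by rewrite nE addrC addKr.
have cE : rnorm z * q = toRe z by rewrite /q mulrC divfK // gt_eqF.
have [im0|im0] := leP 0 (toIm z).
  exists (rnorm z), (acos q); split=> //; first by left; lra.
  rewrite acosK // sE cE ger0_norm //; by case: (z).
exists (rnorm z), (- acos q); split=> //; first by left; lra.
rewrite cosN sinN acosK // mulrN sE cE ltr0_norm // opprK; by case: (z).
Qed.

End Sector.

Section InnerProduct.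
Variables (R : realType) (H : hilbertType R).
Local Notation C := (Cx R).
Implicit Types x y : H.

Lemma inner_diag x : inner x x = toC (rnorm x ^+ 2).
Proof. by rewrite inner_norm rnormE expr2 -toCM -expr2. Qed.

Lemma inner_semi_inner : semi_inner (@inner R H).
Proof.
split=> [|x y|x]; last by rewrite inner_diag toReK sqr_ge0.
  by split=> c x y z; rewrite (linearPl, linearPr).
by rewrite hermitian_subproof expr0 mul1r.
Qed.

Lemma inner_seminorm x : seminorm (@inner R H) x = rnorm x.
Proof. by rewrite /seminorm inner_diag toReK sqrtr_sqr ger0_norm ?rnorm_ge0. Qed.

Lemma rnorm_inner x y : rnorm (inner x y) <= rnorm x * rnorm y.
Proof. by have := cauchy_schwarz inner_semi_inner x y; rewrite !inner_seminorm. Qed.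

End InnerProduct.

(** * Approximate solutions and the resolvent *)

Section ResolventGraph.
Variable R : realType.
Local Notation C := (Cx R).
Variables (H : hilbertType R) (E : lmodType C).

(** The norms of the form domain for all vertices, and the one in which [b] is
    coercive, differ only in the weight [s] of the second term. *)
Definition energy (a : E -> E -> C) (j : E -> H) (s : R) (u : E) : R :=
  Num.sqrt (toRe (a u u) + s * rnorm (j u) ^+ 2).

(** Quasi-sectoriality with vertex [g], see [is_vertexP]. *)
Definition sector_bound (a : E -> E -> C) (j : E -> H) (M g : R) :=
  forall u, rnorm (shift_form a j g u u) <= M * toRe (shift_form a j g u u).

Definition lower_bound (a : E -> E -> C) (j : E -> H) (g : R) :=
  forall u, g * rnorm (j u) ^+ 2 <= toRe (a u u).

(** Here [shift_form a j (- l)] is [b], and the seminorm of its real part is the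
    energy of weight [l]. *)
Definition approx_solution (a : E -> E -> C) (j : E -> H) (l : R) (x : H)
    (e : R) (u : E) :=
  forall z, rnorm (shift_form a j (- l) u z - inner x (j z)) <=
    e * energy a j l z.

(** This is [(l + A)^-1 x = y] expressed without vertices and completions. *)
Definition resolvent_graph (a : E -> E -> C) (j : E -> H) (l : R) (x y : H) :=
  forall e, 0 < e ->
    exists2 u, approx_solution a j l x e u & rnorm (j u - y) <= e.

Variables (a : E -> E -> C) (j : {linear E -> H}).
Hypothesis aP : sesquilinear a.

Lemma shift_form_sesq g : sesquilinear (shift_form a j g).
Proof.
have iP := semi_inner_sesq (inner_semi_inner H).
by split=> c x y z; rewrite /shift_form linearP (sesqPl aP, sesqPr aP)
  (sesqPl iP, sesqPr iP); ring.
Qed.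

Lemma shift_form_diag g u :
  toRe (shift_form a j g u u) = toRe (a u u) - g * rnorm (j u) ^+ 2.
Proof. by rewrite /shift_form toReB toReMl inner_diag toReK. Qed.

Lemma seminorm_shift_form g u :
  seminorm (re_form (shift_form a j g)) u = energy a j (- g) u.
Proof. by rewrite /seminorm re_form_diag shift_form_diag /energy mulNr. Qed.

Lemma vertex_seminormE g u : vertex_seminorm a j g u = energy a j (1 - g) u.
Proof.
by rewrite /vertex_seminorm /vertex_sip toReD toReMl re_form_diag inner_diag toReK.
Qed.

Lemma form_sip_seminorm g u :
  seminorm (form_sip (shift_form a j g) j) u = energy a j (1 - g) u.
Proof.
rewrite /seminorm /form_sip toReD re_form_diag shift_form_diag inner_diag toReK.
by rewrite /energy; congr Num.sqrt; ring.
Qed.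

Lemma sector_bound_lower M g : 1 <= M -> sector_bound a j M g -> lower_bound a j g.
Proof.
move=> M1 aM u; have := le_trans (rnorm_ge0 _) (aM u).
by rewrite pmulr_rge0 ?shift_form_diag ?subr_ge0 //; lra.
Qed.

Lemma sector_bound_le M g g' : 1 <= M -> g' <= g ->
  sector_bound a j M g -> sector_bound a j M g'.
Proof.
move=> M1 gg aM u; have h := aM u.
have n0 := sqr_ge0 (rnorm (j u)).
have -> : shift_form a j g' u u =
    shift_form a j g u u + toC ((g - g') * rnorm (j u) ^+ 2).
  by rewrite /shift_form inner_diag -!toCM mulrBl toCB; ring.
apply: le_trans (rnormD _ _) _.
have d0 : 0 <= (g - g') * rnorm (j u) ^+ 2 by rewrite mulr_ge0 // subr_ge0.
by rewrite rnorm_toC (ger0_norm d0) toReD toReK mulrDr lerD // ler_peMl.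
Qed.

Lemma is_vertexP g :
  is_vertex a j g <-> exists2 M : R, 1 <= M & sector_bound a j M g.
Proof.
have E' u : a u u - toC g * `|j u| ^+ 2 = shift_form a j g u u.
  by rewrite /shift_form inner_norm.
split=> [[theta /closure_sector_bound[M M1 hM] aM]|[M M1 aM]].
  by exists M => // u; rewrite -E'; exact/hM/aM.
have [theta ht hM] := bound_closure_sector M1.
by exists theta => // u; rewrite E'; exact/hM/aM.
Qed.

Section LowerBound.
Variable g : R.
Hypothesis ag : lower_bound a j g.

Lemma sqr_energy s u : - g <= s ->
  energy a j s u ^+ 2 = toRe (a u u) + s * rnorm (j u) ^+ 2.
Proof.
move=> gs; rewrite sqr_sqrtr //; have := ag u.
have := sqr_ge0 (rnorm (j u)); nra.
Qed.

Lemma energy_ge0 s u : 0 <= energy a j s u. Proof. exact: sqrtr_ge0. Qed.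

Lemma energy_j s u : - g < s ->
  rnorm (j u) <= (Num.sqrt (s + g))^-1 * energy a j s u.
Proof.
move=> gs; have sg : 0 < s + g by lra.
rewrite mulrC ler_pdivlMr ?sqrtr_gt0 //.
rewrite -(@ler_pXn2r _ 2) ?nnegrE ?mulr_ge0 ?rnorm_ge0 ?sqrtr_ge0 //.
rewrite exprMn sqr_sqrtr ?(ltW sg) // sqr_energy ?(ltW gs) //.
have := ag u; lra.
Qed.

(** The part [Re a - g |j u|^2] of the energy is nonnegative and common to both
    sides, and the weights of [|j u|^2] beyond it are comparable. *)
Lemma energy_equiv s t : - g < s -> - g < t -> exists2 k : R, 0 < k &
  forall u, energy a j s u <= k * energy a j t u.
Proof.
move=> gs gt; have sg : 0 < s + g by lra.
have tg : 0 < t + g by lra.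
have r0 : 0 < (s + g) / (t + g) by rewrite divr_gt0.
exists (1 + (s + g) / (t + g)) => [|u]; first by rewrite addr_gt0.
set k := 1 + _; have k1 : 1 <= k by rewrite lerDl ltW.
have kt : s + g <= k * (t + g).
  by rewrite /k mulrDl divfK ?gt_eqF // mul1r lerDr ltW.
rewrite -(@ler_pXn2r _ 2) ?nnegrE ?mulr_ge0 ?energy_ge0 //; last lra.
rewrite exprMn !sqr_energy ?(ltW gs) ?(ltW gt) //.
have P0 : 0 <= toRe (a u u) - g * rnorm (j u) ^+ 2 by rewrite subr_ge0.
have n0 := sqr_ge0 (rnorm (j u)).
set P := toRe (a u u) - _ in P0; set n := rnorm (j u) ^+ 2 in P n0 P0 *.
have -> : toRe (a u u) + s * n = P + (s + g) * n by rewrite /P; ring.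
have -> : toRe (a u u) + t * n = P + (t + g) * n by rewrite /P; ring.
have k2 : k <= k ^+ 2 by rewrite expr2 ler_peMl //; lra.
have h1 : P <= k ^+ 2 * P by rewrite ler_peMl //; lra.
have h2 : (s + g) * n <= k ^+ 2 * ((t + g) * n).
  rewrite mulrA ler_wpM2r //; apply: le_trans kt _.
  by rewrite ler_wpM2r // ltW.
lra.
Qed.

End LowerBound.

Variables (M gamma l : R).
Hypotheses (M1 : 1 <= M) (aM : sector_bound a j M gamma) (gl : - gamma < l).
Let ag := sector_bound_lower M1 aM.
Local Notation b := (shift_form a j (- l)).
Local Notation N := (energy a j l).
Let kappa := (Num.sqrt (l + gamma))^-1.
Let bP : sesquilinear b := shift_form_sesq (- l).

Lemma resolvent_diag u : toRe (b u u) = N u ^+ 2.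
Proof. by rewrite shift_form_diag (sqr_energy ag) ?(ltW gl) // mulNr opprK. Qed.

Lemma resolvent_semi_inner : semi_inner (re_form b).
Proof.
by apply: semi_inner_re_form => // u; rewrite resolvent_diag sqr_ge0.
Qed.

Lemma resolvent_seminorm u : seminorm (re_form b) u = N u.
Proof. by rewrite seminorm_shift_form opprK. Qed.

Lemma resolvent_bound u v : rnorm (b u v) <= 2 * M * (N u * N v).
Proof.
rewrite -!resolvent_seminorm.
apply: (diag_bound resolvent_semi_inner bP) => [|x]; first by have := M1; lra.
rewrite resolvent_seminorm -resolvent_diag.
by apply: (sector_bound_le M1 _ aM); have := gl; lra.
Qed.

Lemma energyD u v : N (u + v) <= N u + N v.
Proof. by rewrite -!resolvent_seminorm (seminormD resolvent_semi_inner). Qed.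

Lemma energyBC u v : N (u - v) = N (v - u).
Proof. by rewrite -!resolvent_seminorm (seminormBC resolvent_semi_inner). Qed.

Lemma kappa_ge0 : 0 <= kappa. Proof. by rewrite invr_ge0 sqrtr_ge0. Qed.

(** Coercivity: test the difference of both equations with [u - u'] itself. *)
Lemma approx_solution_stable x x' e e' u u' : 0 <= e -> 0 <= e' ->
  approx_solution a j l x e u -> approx_solution a j l x' e' u' ->
  N (u - u') <= e + e' + kappa * rnorm (x - x').
Proof.
move=> e0 e'0 xu xu'; set w := u - u'.
have N0 : 0 <= N w by exact: energy_ge0.
have iP := semi_inner_sesq (inner_semi_inner H).
have [w0|w0] := eqVneq (N w) 0.
  by rewrite w0 !addr_ge0 // mulr_ge0 ?kappa_ge0 ?rnorm_ge0.
have wp : 0 < N w by rewrite lt_def w0.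
rewrite -(ler_pM2l wp) -expr2 -resolvent_diag.
apply: le_trans (toRe_le_rnorm _) _.
have -> : b w w = (b u w - inner x (j w)) - (b u' w - inner x' (j w))
    + inner (x - x') (j w).
  by rewrite (sesqBl iP) {1}/w (sesqBl bP); ring.
apply: le_trans (rnormD _ _) _.
have h1 := rnormB (b u w - inner x (j w)) (b u' w - inner x' (j w)).
have h2 := xu w; have h3 := xu' w.
have h4 := rnorm_inner (x - x') (j w).
have h5 : rnorm (x - x') * rnorm (j w) <= rnorm (x - x') * (kappa * N w).
  by rewrite ler_wpM2l ?rnorm_ge0 // (energy_j ag).
lra.
Qed.

Lemma approx_solution_exists x e : 0 < e -> exists u, approx_solution a j l x e u.
Proof.
move=> e0; have iP := semi_inner_sesq (inner_semi_inner H).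
have b0 u : 0 <= toRe (b u u) by rewrite resolvent_diag sqr_ge0.
have bM u v : rnorm (b u v) <= 2 * M *
    (seminorm (re_form b) u * seminorm (re_form b) v).
  by rewrite !resolvent_seminorm; exact: resolvent_bound.
have [||u hu] := lax_milgram bP b0 bM
    (phi := fun z => inner x (j z)) (M := kappa * rnorm x) _ _ e0.
- by move=> c y z; rewrite linearP (sesqPr iP).
- move=> z; rewrite resolvent_seminorm mulrAC mulrC.
  apply: le_trans (rnorm_inner _ _) _; rewrite ler_wpM2l ?rnorm_ge0 //.
  exact: (energy_j ag).
by exists u => z; have := hu z; rewrite resolvent_seminorm.
Qed.

(** Approximate solutions with residuals tending to [0] form a Cauchy sequence
    for the energy, and [j] maps it to a Cauchy sequence in the complete space
    [H]. *)
Lemma resolvent_graph_exists x : exists y, resolvent_graph a j l x y.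
Proof.
pose e_ n : R := n.+1%:R^-1.
have e_gt0 n : 0 < e_ n by rewrite invr_gt0 ltr0n.
have sol n := cid (approx_solution_exists x (e_gt0 n)).
pose s n := sval (sol n).
have sP n : approx_solution a j l x (e_ n) (s n) := svalP (sol n).
have js m n : rnorm (j (s m) - j (s n)) <= kappa * (e_ m + e_ n).
  rewrite -linearB; apply: le_trans (energy_j ag _ gl) _.
  rewrite ler_wpM2l ?kappa_ge0 //.
  have := approx_solution_stable (ltW (e_gt0 m)) (ltW (e_gt0 n)) (sP m) (sP n).
  by rewrite subrr rnorm0 mulr0 addr0.
have k0 : 0 < 2 * kappa + 1 by have := kappa_ge0; lra.
have [y sy] : exists y, tends (fun n => j (s n)) y.
  apply: cauchy_tends => e e0; have [k hk] := invS_small (divr_gt0 e0 k0).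
  exists k => m n km kn; apply: le_lt_trans (js m n) _.
  have := hk m km; have := hk n kn; rewrite -/(e_ m) -/(e_ n) !ltr_pdivlMr //.
  have := kappa_ge0; have := e_gt0 m; have := e_gt0 n; nra.
exists y => e e0; have [k hk] := invS_small e0.
have nk : \forall n \near \oo, (k <= n)%N by exists k.
have [n [kn ny]] := filter_ex (filterI nk (sy e e0)).
exists (s n); last exact: ltW.
move=> z; apply: le_trans (sP n z) _; rewrite ler_wpM2r ?energy_ge0 //.
exact/ltW/hk.
Qed.

Lemma resolvent_graph_lipschitz x x' y y' :
  resolvent_graph a j l x y -> resolvent_graph a j l x' y' ->
  rnorm (y - y') <= kappa ^+ 2 * rnorm (x - x').
Proof.
move=> xy xy'; apply/ler_addgt0Pr => e e0; have k0 := kappa_ge0.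
have D0 : 0 < 2 * kappa + 2 by lra.
have d0 := divr_gt0 e0 D0; set d := e / _ in d0.
have [u xu uy] := xy d d0; have [u' xu' uy'] := xy' d d0.
have h := ler_wpM2l k0 (approx_solution_stable (ltW d0) (ltW d0) xu xu').
have h1 := le_trans (energy_j ag (u - u') gl) h.
have -> : y - y' = j (u - u') - (j u - y) + (j u' - y').
  by rewrite linearB opprB [j u - j u' + _]addrC !subrKA.
apply: le_trans (rnormD _ _) _.
have h2 := rnormB (j (u - u')) (j u - y).
have dE : d * (2 * kappa + 2) = e by rewrite /d divfK // gt_eqF.
move: h1; rewrite -/kappa; lra.
Qed.

Lemma resolvent_graph_comb c x x' y y' :
  resolvent_graph a j l x y -> resolvent_graph a j l x' y' ->
  resolvent_graph a j l (c *: x + x') (c *: y + y').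
Proof.
move=> xy xy' e e0; have D0 : 0 < rnorm c + 1 by rewrite ltr_wpDl ?rnorm_ge0.
have d0 := divr_gt0 e0 D0; set d := e / _ in d0.
have dE : d * (rnorm c + 1) = e by rewrite /d divfK // gt_eqF.
have iP := semi_inner_sesq (inner_semi_inner H).
have [u xu uy] := xy d d0; have [u' xu' uy'] := xy' d d0.
exists (c *: u + u') => [z|].
  have -> : b (c *: u + u') z - inner (c *: x + x') (j z) =
      c * (b u z - inner x (j z)) + (b u' z - inner x' (j z)).
    by rewrite (sesqPl bP) (sesqPl iP); ring.
  apply: le_trans (rnormD _ _) _; rewrite rnormM -dE mulrDr mulr1 mulrDl.
  rewrite lerD //.
  by rewrite [d * _]mulrC -mulrA ler_wpM2l ?rnorm_ge0.
rewrite linearP opprD addrACA -scalerBr.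
apply: le_trans (rnormD _ _) _; rewrite rnormZ -dE mulrDr mulr1 lerD //.
by rewrite mulrC ler_wpM2r ?rnorm_ge0.
Qed.

Lemma resolvent_operator : exists T : {linear H -> H},
  continuous T /\ forall x y, resolvent_graph a j l x y <-> y = T x.
Proof.
pose T x := sval (cid (resolvent_graph_exists x)).
have TP x : resolvent_graph a j l x (T x) := svalP (cid (resolvent_graph_exists x)).
have uniq x y : resolvent_graph a j l x y -> y = T x.
  move=> xy; apply/subr0_eq/rnorm_eq0/eqP; rewrite eq_le rnorm_ge0 andbT.
  by have := resolvent_graph_lipschitz xy (TP x); rewrite subrr rnorm0 mulr0.
have Tlin : linear T.
  by move=> c x y; apply/esym/uniq; exact: resolvent_graph_comb.
exists (bundle_linear Tlin); split=> [|x y]; last first.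
  by split=> [/uniq //|->]; exact: TP.
apply: (@linear_bound_continuous _ _ _ _ (kappa ^+ 2)) => x.
have := resolvent_graph_lipschitz (TP x) (TP 0).
have -> : T 0 = 0 by exact: (linear0 (bundle_linear Tlin)).
by rewrite !subr0.
Qed.

End ResolventGraph.

(** * The resolvent of the associated relation *)

Section AssociatedRelation.
Variable R : realType.
Local Notation C := (Cx R).
Variables (H : hilbertType R) (E : lmodType C).
Variables (a : E -> E -> C) (j : {linear E -> H}).
Hypothesis aP : sesquilinear a.

(** The larger of the two vertices is still a lower bound for [Re a], and both
    weights [l] and [1 - g] exceed its opposite. *)
Lemma energy_le_vertex (g gamma l : R) :
  is_vertex a j g -> is_vertex a j gamma -> - gamma < l ->
  exists2 k : R, 0 < k & forall u, energy a j l u <= k * energy a j (1 - g) u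
    /\ energy a j (1 - g) u <= k * energy a j l u.
Proof.
move=> /is_vertexP[M M1 /(sector_bound_lower M1) ag].
move=> /is_vertexP[M' M'1 /(sector_bound_lower M'1) agamma] gl.
have [m [am gm gammam]] : exists m, [/\ lower_bound a j m, g <= m & gamma <= m].
  by have [h|h] := leP g gamma; [exists gamma|exists g]; split => //; exact: ltW.
have h1 : - m < l by lra.
have h2 : - m < 1 - g by lra.
have [k k0 hk] := energy_equiv am h1 h2; have [k' k'0 hk'] := energy_equiv am h2 h1.
exists (k + k') => [|u]; first lra.
have e1 := energy_ge0 a j l u; have e2 := energy_ge0 a j (1 - g) u.
have := hk u; have := hk' u; split; nra.
Qed.

Lemma form_sip_shift g :
  form_sip (shift_form a j g) j = re_form (shift_form a j (g - 1)).
Proof.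
apply/funext => u; apply/funext => v.
have ih := semi_inner_herm (inner_semi_inner H).
rewrite /form_sip /re_form /shift_form !rmorphB !rmorphM /= !toC_conj.
rewrite (ih (j u) (j v)) conjCK toCB [toC 1]toC1; by field.
Qed.

Lemma compl_map_rnorm g (k : form_completion (shift_form a j g) j) u :
  rnorm (compl_map k u) = energy a j (1 - g) u.
Proof.
by rewrite -inner_seminorm /seminorm -compl_sip -form_sip_seminorm.
Qed.

Lemma compl_map_dense (b : E -> E -> C) (k : form_completion b j) u (e : R) :
  0 < e -> exists x, rnorm (u - compl_map k x) < e.
Proof.
move=> e0; have e0C : (0 : C) < toC e by rewrite (toC_lt 0).
have [|v [uv [x _ xv]]] :=
  compl_dense (f := k) (O := ball u (toC e)) _ (ball_open u (toC e)).
  by exists u; exact: ballxx.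
by exists x; move: uv; rewrite -xv -ball_normE /ball_ /= rnormE toC_lt.
Qed.

Variables (M gamma l : R).
Hypotheses (M1 : 1 <= M) (aM : sector_bound a j M gamma) (gl : - gamma < l).
Let ag := sector_bound_lower M1 aM.
Let aV : is_vertex a j gamma.
Proof. by apply/is_vertexP; exists M. Qed.

Lemma shift_form_shift g u v : shift_form a j (- l) u v =
  shift_form a j g u v + toC (g + l) * inner (j u) (j v).
Proof. by rewrite /shift_form toCD toCN; ring. Qed.

(** Elements of the domain close to a solution in the completion are
    approximate solutions, whatever vertex and completion were used. *)
Lemma sectorial_relation_graph g y w : is_vertex a j g ->
  sectorial_relation (shift_form a j g) j (y, w) ->
  resolvent_graph a j l (w + toC (g + l) *: y) y.
Proof.
move=> gV [k [u /= uy uw]] e e0.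
have iP := semi_inner_sesq (inner_semi_inner H).
have fP := sesquiform_sesq (compl_form k).
have [F F0 hF] := continuous_form_bound fP (compl_form_continuous (f := k)).
have [c c0 hc] := continuous_linear_bound (compl_j_continuous (f := k)).
have [m m0 hm] := energy_le_vertex gV aV gl.
pose kappa := (Num.sqrt (l + gamma))^-1.
have kappa0 : 0 <= kappa by rewrite invr_ge0 sqrtr_ge0.
pose L := F * m + `|g + l| * c * kappa + c + 1.
have L0 : 0 < L.
  by rewrite ltr_wpDl // !addr_ge0 // !mulr_ge0 // ltW.
have d0 := divr_gt0 e0 L0; set d := e / L in d0.
have dL : d * L = e by rewrite /d divfK // gt_eqF.
have [x ux] := compl_map_dense u d0.
have jx : rnorm (j x - y) <= c * d.
  rewrite -(compl_jE k) -uy -linearB; apply: le_trans (hc _) _.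
  by rewrite rnormBC ler_wpM2l // ltW.
exists x => [z|]; last first.
  apply: le_trans jx _; rewrite -dL /L mulrC ler_wpM2l ?(ltW d0) //.
  have : 0 <= F * m + `|g + l| * c * kappa.
    by rewrite addr_ge0 // !mulr_ge0 // ltW.
  lra.
have -> : shift_form a j (- l) x z - inner (w + toC (g + l) *: y) (j z) =
    compl_form k (compl_map k x - u) (compl_map k z)
    + toC (g + l) * inner (j x - y) (j z).
  rewrite (sesqBl fP) (sesqBl iP) (sesqDl iP) (sesqZl iP) uw compl_jE.
  by rewrite compl_formE (shift_form_shift g); ring.
apply: le_trans (rnormD _ _) _; rewrite rnormM rnorm_toC.
have [_ hz] := hm z; have Nz := energy_ge0 a j l z.
have h1 : rnorm (compl_form k (compl_map k x - u) (compl_map k z)) <=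
    F * (d * (m * energy a j l z)).
  apply: le_trans (hF _ _) _; rewrite ler_wpM2l // ler_pM ?rnorm_ge0 //.
    by rewrite rnormBC ltW.
  by rewrite compl_map_rnorm.
have h2 : `|g + l| * rnorm (inner (j x - y) (j z)) <=
    `|g + l| * (c * d * (kappa * energy a j l z)).
  rewrite ler_wpM2l //; apply: le_trans (rnorm_inner _ _) _.
  by rewrite ler_pM ?rnorm_ge0 // (energy_j ag).
apply: le_trans (lerD h1 h2) _; rewrite -dL /L.
have := mulr_ge0 (mulr_ge0 c0 (ltW d0)) Nz.
have := mulr_ge0 (ltW d0) Nz; lra.
Qed.

(** The limit in the completion of approximate solutions is an exact solution:
    first for test vectors from the domain, then for all of them by density. *)
Lemma graph_sectorial_relation x y : resolvent_graph a j l x y ->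
  sectorial_relation (shift_form a j gamma) j (y, x - toC (gamma + l) *: y).
Proof.
move=> xy; have iP := semi_inner_sesq (inner_semi_inner H).
have SP := shift_form_sesq j aP gamma.
have gs : - gamma < 1 - gamma by lra.
have pP : semi_inner (form_sip (shift_form a j gamma) j).
  rewrite form_sip_shift; apply: semi_inner_re_form; first exact: shift_form_sesq.
  move=> u; rewrite shift_form_diag; have := ag u.
  by have := sqr_ge0 (rnorm (j u)); lra.
have K0 : 0 <= 2 * M by have := M1; lra.
have SK u v : rnorm (shift_form a j gamma u v) <= 2 * M *
    (seminorm (form_sip (shift_form a j gamma) j) u *
     seminorm (form_sip (shift_form a j gamma) j) v).
  apply: (diag_bound pP SP) => [|z]; first by have := M1; lra.
  apply: le_trans (aM z) _; rewrite ler_wpM2l //; first by have := M1; lra.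
  rewrite form_sip_seminorm (sqr_energy ag) ?(ltW gs) // shift_form_diag.
  by have := sqr_ge0 (rnorm (j z)); lra.
have j1 u : rnorm (j u) <= seminorm (form_sip (shift_form a j gamma) j) u.
  have := energy_j ag u gs.
  by rewrite subrK sqrtr1 invr1 mul1r form_sip_seminorm.
have [k] := form_completion_exists SP pP K0 SK j1.
pose e_ n : R := n.+1%:R^-1.
have e_gt0 n : 0 < e_ n by rewrite invr_gt0 ltr0n.
have sol n : {u | approx_solution a j l x (e_ n) u /\ rnorm (j u - y) <= e_ n}.
  by apply: cid; have [u xu uy] := xy _ (e_gt0 n); exists u.
pose s n := sval (sol n).
have sx n : approx_solution a j l x (e_ n) (s n) := (svalP (sol n)).1.
have sy n : rnorm (j (s n) - y) <= e_ n := (svalP (sol n)).2.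
have [m m0 hm] := energy_le_vertex aV aV gl.
have [u su] : exists u, tends (fun n => compl_map k (s n)) u.
  apply: cauchy_tends => e e0; have D0 : 0 < 2 * m + 1 by lra.
  have [i hi] := invS_small (divr_gt0 e0 D0); exists i => p n ip iN.
  rewrite -linearB compl_map_rnorm; apply: le_lt_trans (hm _).2 _.
  have := approx_solution_stable aP M1 aM gl
    (ltW (e_gt0 p)) (ltW (e_gt0 n)) (sx p) (sx n).
  rewrite subrr rnorm0 mulr0 addr0 => h.
  apply: le_lt_trans (ler_wpM2l (ltW m0) h) _.
  have := hi p ip; have := hi n iN; rewrite -/(e_ p) -/(e_ n) !ltr_pdivlMr //.
  have := e_gt0 p; have := e_gt0 n; nra.
have fP := sesquiform_sesq (compl_form k).
have [F F0 hF] := continuous_form_bound fP (compl_form_continuous (f := k)).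
have [c c0 hc] := continuous_linear_bound (compl_j_continuous (f := k)).
have js : tends (fun n => j (s n)) y.
  move=> e e0; have [i hi] := invS_small e0; exists i => // n /= iN.
  exact: le_lt_trans (sy n) (hi n iN).
have uy : compl_j k u = y.
  apply: tends_uniq js => e e0; have D0 : 0 < c + 1 by lra.
  apply: filterS (su _ (divr_gt0 e0 D0)) => n.
  rewrite ltr_pdivlMr // -(compl_jE k) -linearB => h.
  apply: le_lt_trans (hc _) (le_lt_trans _ h).
  by have := rnorm_ge0 (compl_map k (s n) - u); lra.
set w := x - toC (gamma + l) *: y.
have on_range z : compl_form k u (compl_map k z) = inner w (j z).
  have Nz := rnorm_ge0 (compl_map k z).
  have h1 : tends (fun n => compl_form k (compl_map k (s n)) (compl_map k z))
      (compl_form k u (compl_map k z)).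
    move=> e e0; have D0 : 0 < F * rnorm (compl_map k z) + 1.
      by rewrite ltr_wpDl // mulr_ge0.
    apply: filterS (su _ (divr_gt0 e0 D0)) => n.
    rewrite ltr_pdivlMr // -(sesqBl fP) => h.
    apply: le_lt_trans (hF _ _) (le_lt_trans _ h).
    by have := rnorm_ge0 (compl_map k (s n) - u); lra.
  apply: tends_uniq h1 _ => e e0.
  have D0 : 0 < energy a j l z + `|gamma + l| * rnorm (j z) + 1.
    by rewrite ltr_wpDl // addr_ge0 ?energy_ge0 // mulr_ge0 // rnorm_ge0.
  have [i hi] := invS_small (divr_gt0 e0 D0); exists i => // n /= iN.
  have -> : compl_form k (compl_map k (s n)) (compl_map k z) - inner w (j z) =
      (shift_form a j (- l) (s n) z - inner x (j z))
      - toC (gamma + l) * inner (j (s n) - y) (j z).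
    rewrite compl_formE (shift_form_shift gamma) /w (sesqBl iP) (sesqBl iP).
    by rewrite (sesqZl iP); ring.
  apply: le_lt_trans (rnormB _ _) _; rewrite rnormM rnorm_toC.
  have h2 : `|gamma + l| * rnorm (inner (j (s n) - y) (j z)) <=
      `|gamma + l| * (e_ n * rnorm (j z)).
    rewrite ler_wpM2l //; apply: le_trans (rnorm_inner _ _) _.
    by rewrite ler_wpM2r ?rnorm_ge0.
  apply: le_lt_trans (lerD (sx n z) h2) _.
  have := hi n iN; rewrite -/(e_ n) ltr_pdivlMr //; have := e_gt0 n; lra.
exists k; exists u => //= v; apply/subr0_eq/rnorm_eq0/eqP.
rewrite eq_le rnorm_ge0 andbT; apply/ler_addgt0Pr => e e0; rewrite add0r.
have D0 : 0 < F * rnorm u + rnorm w * c + 1.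
  by rewrite ltr_wpDl // addr_ge0 // mulr_ge0 ?rnorm_ge0.
have [z vz] := compl_map_dense v (divr_gt0 e0 D0).
have -> : compl_form k u v - inner w (compl_j k v) =
    compl_form k u (v - compl_map k z) - inner w (compl_j k (v - compl_map k z)).
  by rewrite (sesqBr fP) linearB (sesqBr iP) on_range compl_jE; ring.
apply: le_trans (rnormB _ _) _.
have h1 := hF u (v - compl_map k z).
have h2 : rnorm (inner w (compl_j k (v - compl_map k z))) <=
    rnorm w * (c * rnorm (v - compl_map k z)).
  by apply: le_trans (rnorm_inner _ _) _; rewrite ler_wpM2l ?rnorm_ge0.
rewrite ltr_pdivlMr // in vz.
have := rnorm_ge0 (v - compl_map k z); lra.
Qed.

Lemma resolvent_graphE : inv_relation (shift_relation l (associated_relation a j))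
  = [set xy | resolvent_graph a j l xy.1 xy.2].
Proof.
apply/seteqP; split=> [_ [_ [[y w0] [g gV [[y' w] yw [<- <-]]] <-] <-]|[x y] xy] /=.
  rewrite -addrA -scalerDl -toCD; exact: sectorial_relation_graph.
exists (y, x) => //; exists (y, x - toC l *: y) => /=; last by rewrite subrK.
exists gamma; first exact: aV.
exists (y, x - toC (gamma + l) *: y); first exact: graph_sectorial_relation.
by rewrite /= toCD scalerDl opprD addrA addrAC subrK.
Qed.

Lemma is_resolventP (T : {linear H -> H}) : continuous T ->
  (forall x y, resolvent_graph a j l x y <-> y = T x) ->
  is_resolvent (associated_relation a j) l T.
Proof.
move=> Tc TP; split=> //; rewrite resolvent_graphE.
by apply/seteqP; split=> -[x y] /=; rewrite TP.
Qed.

End AssociatedRelation.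

(** * Convergence of the resolvents *)

Section Convergence.
Variable R : realType.
Local Notation C := (Cx R).
Variables (H : hilbertType R) (E E' : lmodType C).
Variables (a : E -> E -> C) (j : {linear E -> H}).
Variables (a' : E' -> E' -> C) (i : {linear E' -> E}) (j' : {linear E' -> H}).
Hypotheses (aP : sesquilinear a) (aP' : sesquilinear a').
Hypothesis jE : forall u, j' u = j (i u).
Local Notation c := (fun u v => a' u v - a (i u) (i v)).

Lemma form_diff_sesq : sesquilinear c.
Proof.
by split=> k x y z; rewrite linearP (sesqPl aP', sesqPr aP')
  (sesqPl aP, sesqPr aP); ring.
Qed.

Variables (M M' gamma l : R).
Hypotheses (M1 : 1 <= M) (aM : sector_bound a j M gamma) (gl : - gamma < l).
Hypotheses (M'1 : 1 <= M') (cM : forall u, rnorm (c u u) <= M' * toRe (c u u)).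

Lemma form_diff_ge0 u : 0 <= toRe (c u u).
Proof.
by have := le_trans (rnorm_ge0 _) (cM u); rewrite pmulr_rge0 //; have := M'1; lra.
Qed.

Lemma form_diff_bound u v : rnorm (c u v) <=
  2 * M' * (Num.sqrt (toRe (c u u)) * Num.sqrt (toRe (c v v))).
Proof.
have pP := semi_inner_re_form form_diff_sesq form_diff_ge0.
have sE w : seminorm (re_form c) w = Num.sqrt (toRe (c w w)).
  by rewrite /seminorm re_form_diag.
rewrite -!sE; apply: (diag_bound pP form_diff_sesq) => [|w].
  by have := M'1; lra.
by apply: le_trans (cM w) _; rewrite (sqr_seminorm pP) re_form_diag.
Qed.

(** [a' - gamma (j' | j')] is the sum of two forms with values in sectors, and
    the inequality [|z| <= M Re z] is stable under sums. *)
Lemma sector_bound_restrict : sector_bound a' j' (Num.max M M') gamma.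
Proof.
move=> u; have -> : shift_form a' j' gamma u u =
    shift_form a j gamma (i u) (i u) + c u u.
  by rewrite /shift_form !jE; ring.
apply: le_trans (rnormD _ _) _; rewrite toReD mulrDr.
have a0 : 0 <= toRe (shift_form a j gamma (i u) (i u)).
  by have := le_trans (rnorm_ge0 _) (aM (i u)); rewrite pmulr_rge0 //; have := M1; lra.
apply: lerD; first apply: le_trans (aM _) _; last apply: le_trans (cM _) _.
  by rewrite ler_wpM2r // le_max lexx.
by rewrite ler_wpM2r ?form_diff_ge0 // le_max lexx orbT.
Qed.

Let aM' := sector_bound_restrict.
Let M'' : 1 <= Num.max M M'. Proof. by rewrite le_max M1. Qed.

(** The identity behind the estimate: the energy for the smaller domain also
    controls [Re (a' - a)]. *)
Lemma sqr_energy_restrict u :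
  energy a' j' l u ^+ 2 = energy a j l (i u) ^+ 2 + toRe (c u u).
Proof.
rewrite (sqr_energy (sector_bound_lower M1 aM)) ?(ltW gl) //.
rewrite (sqr_energy (sector_bound_lower M'' aM')) ?(ltW gl) //.
by rewrite jE toReB; ring.
Qed.

(** A Cea-Strang estimate: both equations are tested with [w - v], which lies
    in the smaller domain, and subtracted; each remaining term is a multiple of
    the energy of [w - v], by which one can divide. *)
Lemma energy_error_bound x e u w v : 0 <= e ->
  approx_solution a j l x e u -> approx_solution a' j' l x e w ->
  energy a' j' l (w - v) <= 2 * e + 2 * M * energy a j l (u - i v)
    + 2 * M' * Num.sqrt (toRe (c v v)).
Proof.
move=> e0 xu xw; set z := w - v; set n := energy a' j' l z.
set r := Num.sqrt (toRe (c v v)); set q := energy a j l (u - i v).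
have n0 : 0 <= n by exact: energy_ge0.
have r0 : 0 <= r by exact: sqrtr_ge0.
have q0 : 0 <= q by exact: energy_ge0.
have [->|nn] := eqVneq n 0.
  by rewrite !addr_ge0 ?mulr_ge0 //; [have := M1|have := M'1]; lra.
have np : 0 < n by rewrite lt_def nn.
have niz : energy a j l (i z) <= n.
  rewrite -(@ler_pXn2r _ 2) ?nnegrE ?energy_ge0 // sqr_energy_restrict.
  by rewrite lerDl form_diff_ge0.
have ncz : Num.sqrt (toRe (c z z)) <= n.
  rewrite -(@ler_pXn2r _ 2) ?nnegrE ?sqrtr_ge0 //.
  by rewrite sqr_sqrtr ?form_diff_ge0 // sqr_energy_restrict lerDr sqr_ge0.
rewrite -(ler_pM2l np) -expr2 -(resolvent_diag M'' aM' gl).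
apply: le_trans (toRe_le_rnorm _) _.
have bP := shift_form_sesq j aP (- l); have bP' := shift_form_sesq j' aP' (- l).
have -> : shift_form a' j' (- l) z z =
    (shift_form a' j' (- l) w z - inner x (j' z))
    - (shift_form a j (- l) u (i z) - inner x (j (i z)))
    + shift_form a j (- l) (u - i v) (i z) - c v z.
  rewrite {1}/z (sesqBl bP') (sesqBl bP) /shift_form !jE; ring.
apply: le_trans (rnormB _ _) _; apply: le_trans (lerD (rnormD _ _) (lexx _)) _.
have h1 := rnormB (shift_form a' j' (- l) w z - inner x (j' z))
  (shift_form a j (- l) u (i z) - inner x (j (i z))).
have h2 : rnorm (shift_form a' j' (- l) w z - inner x (j' z)) <= e * n := xw z.
have h3 : rnorm (shift_form a j (- l) u (i z) - inner x (j (i z))) <= e * n.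
  by apply: le_trans (xu (i z)) _; rewrite ler_wpM2l.
have h4 : rnorm (shift_form a j (- l) (u - i v) (i z)) <= 2 * M * (q * n).
  apply: le_trans (resolvent_bound aP M1 aM gl _ _) _.
  by rewrite ler_wpM2l ?ler_wpM2l //; have := M1; lra.
have h5 : rnorm (c v z) <= 2 * M' * (r * n).
  apply: le_trans (form_diff_bound _ _) _.
  by rewrite ler_wpM2l ?ler_wpM2l //; have := M'1; lra.
rewrite /= in h5 *; lra.
Qed.

(** Compare both resolvents through the chain [j' w], [j' v], [j u]. *)
Lemma resolvent_error_bound x e u v y y' : 0 < e ->
  approx_solution a j l x e u -> rnorm (j u - y) <= e ->
  resolvent_graph a' j' l x y' ->
  rnorm (y' - y) <= 2 * e + (Num.sqrt (l + gamma))^-1 *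
    (2 * e + (2 * M + 1) * energy a j l (u - i v)
     + 2 * M' * Num.sqrt (toRe (c v v))).
Proof.
move=> e0 xu uy xy'; have [w xw wy'] := xy' e e0.
have kappa0 : 0 <= (Num.sqrt (l + gamma))^-1 by rewrite invr_ge0 sqrtr_ge0.
have h := energy_error_bound v (ltW e0) xu xw.
have h1 := energy_j (sector_bound_lower M'' aM') (w - v) gl.
have h2 := energy_j (sector_bound_lower M1 aM) (u - i v) gl.
have h3 := le_trans h1 (ler_wpM2l kappa0 h).
have tri (x1 x2 x3 : H) : rnorm (x1 - x3) <= rnorm (x1 - x2) + rnorm (x2 - x3).
  by rewrite -(subrKA x2) rnormD.
have t1 := tri y' (j' w) y; have t2 := tri (j' w) (j' v) y.
have t3 := tri (j' v) (j u) y.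
rewrite (rnormBC y' (j' w)) in t1; rewrite -linearB in t2.
rewrite jE (rnormBC (j (i v)) (j u)) -linearB -jE in t3.
rewrite /= in h3; lra.
Qed.

End Convergence.

Theorem theorem1p1 (R : realType) (H : hilbertType R)
    (E : lmodType (Cx R)) (a : sesquiform R E) (j : {linear E -> H})
    (a_qs : quasi_sectorial a j)
    (S : nat -> pred E) (dom_ : forall n, subLmodType (S n))
    (a_ : forall n, sesquiform R (dom_ n))
    (theta : R) (theta_angle : is_angle theta)
    (a_sect : forall n, sectorial_angle theta
       (fun u v : dom_ n => a_ n u v - a (val u) (val v)))
    (D : set E) (D_core : is_core a j D)
    (D_approx : forall u, D u -> exists u_ : forall n, dom_ n,
       form_cvg a j (fun n => val (u_ n)) u /\
       (a_ n (u_ n) (u_ n) - a (val (u_ n)) (val (u_ n)) : Cx R)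
         @[n --> \oo] --> (0 : Cx R)) :
  forall gamma : R, is_vertex a j gamma -> forall l : R, - gamma < l ->
  resolvents_cvg
    (fun n => associated_relation (a_ n) (fun u : dom_ n => j (val u)))
    (associated_relation a j) l.
Proof.
move=> gamma aV l gl.
have aP := sesquiform_sesq a; have aP_ n := sesquiform_sesq (a_ n).
have [M M1 aM] := (is_vertexP a j gamma).1 aV.
have [M' M'1 hM'] := closure_sector_bound theta_angle.
have cM n (u : dom_ n) := hM' _ (a_sect n u).
pose incl n : {linear dom_ n -> E} := val.
have jlin n : linear (fun u : dom_ n => j (val u)).
  by move=> c u v; rewrite !linearP.
pose j_ n := bundle_linear (jlin n).
have aM_ n : sector_bound (a_ n) (j_ n) (Num.max M M') gamma.
  exact: (@sector_bound_restrict R H E (dom_ n) a j (a_ n) (incl n) (j_ n)).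
have M''1 : 1 <= Num.max M M' by rewrite le_max M1.
have [T [Tc TP]] := resolvent_operator aP M1 aM gl.
have res n := cid (resolvent_operator (aP_ n) M''1 (aM_ n) gl).
pose T_ n : {linear H -> H} := sval (res n).
have T_c n : continuous (T_ n) := (svalP (res n)).1.
have T_P n : forall x y, resolvent_graph (a_ n) (j_ n) l x y <-> y = T_ n x :=
  (svalP (res n)).2.
exists T_, T; split=> [n||x].
- exact: (is_resolventP (aP_ n) M''1 (aM_ n) gl (T_c n) (T_P n)).
- exact: (is_resolventP aP M1 aM gl Tc TP).
apply/cvg_tends => e e0.
pose kappa := (Num.sqrt (l + gamma))^-1.
have k0 : 0 <= kappa by rewrite invr_ge0 sqrtr_ge0.
(* The estimate [resolvent_error_bound] is used with residual [d], with
   [energy (u - v) <= 2 d] and with [sqrt (Re (a_n - a) v v) <= d]. *)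
pose L := 2 + kappa * (2 + (2 * M + 1) * 2 + 2 * M') + 1.
have L0 : 0 < L.
  rewrite /L ltr_wpDl // addr_ge0 // mulr_ge0 //; lra.
have d0 := divr_gt0 e0 L0; set d := e / L in d0.
have dL : d * L = e by rewrite /d divfK // gt_eqF.
have [u xu uy] := (TP x (T x)).2 erefl d d0.
have [_ [g gV gD]] := D_core.
have [m m0 hm] := energy_le_vertex gV aV gl.
have [v Dv uv] := gD u _ (divr_gt0 d0 m0).
have {}uv : energy a j l (u - v) < d.
  apply: le_lt_trans (hm _).1 _.
  by rewrite mulrC -ltr_pdivlMr // -vertex_seminormE.
have [v_ [[g' g'V /cvgr0Pnorm_lt vv] /cvg_tends cv]] := D_approx v Dv.
have [m' m'0 hm'] := energy_le_vertex g'V aV gl.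
have near_v := vv _ (divr_gt0 d0 m'0).
apply: filterS2 near_v (cv _ (exprn_gt0 2 d0)) => n vn cn.
have {}vn : energy a j l (v - val (v_ n)) < d.
  rewrite (energyBC aP M1 aM gl); apply: le_lt_trans (hm' _).1 _.
  rewrite mulrC -ltr_pdivlMr // -vertex_seminormE.
  exact: le_lt_trans (ler_norm _) vn.
have uvn : energy a j l (u - val (v_ n)) <= 2 * d.
  have := energyD aP M1 aM gl (u - v) (v - val (v_ n)).
  rewrite addrA subrK; lra.
have cvn : Num.sqrt (toRe (a_ n (v_ n) (v_ n) - a (val (v_ n)) (val (v_ n)))) <= d.
  rewrite -[X in _ <= X](ger0_norm (ltW d0)) -sqrtr_sqr ler_sqrt ?sqr_ge0 //.
  by rewrite subr0 in cn; exact: le_trans (toRe_le_rnorm _) (ltW cn).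
have err : rnorm (T_ n x - T x) <= 2 * d + kappa *
    (2 * d + (2 * M + 1) * energy a j l (u - val (v_ n)) + 2 * M' *
     Num.sqrt (toRe (a_ n (v_ n) (v_ n) - a (val (v_ n)) (val (v_ n))))).
  apply: (@resolvent_error_bound R H E (dom_ n) a j (a_ n) (incl n) (j_ n)
    aP (aP_ n) (fun=> erefl) M M' gamma l M1 aM gl M'1 (cM n) x d u (v_ n)) => //.
  exact/T_P.
apply: le_lt_trans err _; rewrite -dL /L.
have h : 2 * d + (2 * M + 1) * energy a j l (u - val (v_ n)) + 2 * M' *
    Num.sqrt (toRe (a_ n (v_ n) (v_ n) - a (val (v_ n)) (val (v_ n)))) <=
    2 * d + (2 * M + 1) * (2 * d) + 2 * M' * d.
  by rewrite !lerD // ler_wpM2l //; lra.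
have := ler_wpM2l k0 h; lra.
Qed.
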